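(* Let $A$ generate a uniformly bounded, strongly stable $C_0$-semigroup $S(t)$ on a Hilbert space $H$. Fix $T>0$ and an integer $m\ge1$, put $\omega_n=2\pi n/T$, and suppose $i\omega_n\in\rho(A)$ for every $n\in\mathbb Z$. Suppose there are distinct integers $n_k$ ($k\ge1$) with $|n_k|\to\infty$ and $c>0$ such that $$\|(i\omega_{n_k}I-A)^{-1}\|_{\mathcal L(H)}\ \ge\ c\,(1+|\omega_{n_k}|)^{m}\qquad\text{for all }k.$$ Then there exists $f\in H^{m-1}_{\#}(0,T;H)$ such that $\dot u=Au+f$ admits no $T$-periodic mild solution; the pair $(T,f)$ is statically, hence secularly, resonant.
   Context: Strongly stable means $S(t)x\to0$ as $t\to\infty$ for every $x\in H$. $H^{m-1}_{\#}(0,T;H)$ is the Sobolev space in time of $T$-periodic $H$-valued functions ($H^0_\#=L^2_\#$). A mild solution of $\dot u=Au+f$ is $u(t)=S(t)u_0+\int_0^tS(t-s)f(s)\,ds$, $t\ge0$, $u_0\in H$. $(T,f)$ is statically resonant if there is no $T$-periodic mild solution, and secularly resonant if some mild solution satisfies $\sup_{t\ge0}\|u(t)\|_H=\infty$. *)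

(* Defs.v *)
From HB Require Import structures.
From mathcomp Require Import all_boot all_order all_algebra.
From mathcomp Require Import all_classical all_reals all_analysis.
From mathcomp Require Import complex.

Set Implicit Arguments.
Unset Strict Implicit.
Unset Printing Implicit Defensive.

Import Order.TTheory GRing.Theory Num.Theory.
Import numFieldNormedType.Exports.

Local Open Scope classical_set_scope.
Local Open Scope complex_scope.
Local Open Scope ring_scope.

(* The norm of a normed module over R[i] takes its values in R[i] (they are
   nonnegative reals there); rnorm is the same norm with values in R. *)
Definition rnorm (R : realType) (H : normedModType R[i]) (x : H) : R :=
  complex.Re `|x|.

Definition opnorm (R : realType) (H : normedModType R[i]) (B : H -> H)
  : \bar R :=
  ereal_sup [set (rnorm (B x))%:E | x in [set x : H | rnorm x <= 1]].

Section Bochner.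
Variables (R : realType) (H : normedModType R[i]).
Implicit Types (D : set R) (f : R -> H).
Let mu := @lebesgue_measure R.

Definition simple_on D (s : R -> H) : Prop :=
  [/\ finite_set (range s),
      forall y, measurable (s @^-1` [set y]) &
      forall y, y != 0 -> (mu (D `&` s @^-1` [set y]) < +oo)%E].

Definition simple_integral D (s : R -> H) : H :=
  \sum_(y \in range s) (fine (mu (D `&` s @^-1` [set y])))%:C *: y.

Definition strongly_measurable_by D f (s : nat -> R -> H) : Prop :=
  (forall n, simple_on D (s n)) /\
  {ae mu, forall x, D x -> s n x @[n --> \oo] --> f x}.

Definition strongly_measurable D f : Prop :=
  exists s, strongly_measurable_by D f s.

(* [is_bochner D f v]: f is Bochner integrable over D with integral v. *)
Definition is_bochner D f (v : H) : Prop :=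
  exists s : nat -> R -> H,
  [/\ strongly_measurable_by D f s,
      (\int[mu]_(x in D) (rnorm (f x - s n x))%:E)%E @[n --> \oo] --> 0%E &
      simple_integral D (s n) @[n --> \oo] --> v].

End Bochner.

Section PeriodicSobolev.
Variables (R : realType) (H : normedModType R[i]) (T : R).

(* Periodic functions on R are identified with their restriction to [0, T]. *)
Definition L2_per (f : R -> H) : Prop :=
  [/\ forall t, f (t + T) = f t,
      strongly_measurable `[0, T] f &
      (\int[@lebesgue_measure R]_(t in `[0%R, T]) (rnorm (f t) ^+ 2)%:E
        < +oo)%E].

Definition smooth_per (phi : R -> R) : Prop :=
  (forall t, phi (t + T) = phi t) /\
  (forall j t, derivable (derive1n j phi) t 1).

(* g is the j-th derivative of f in the sense of periodic distributions:
   \int_0^T phi^(j) f = (-1)^j \int_0^T phi g for all test functions phi. *)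
Definition weak_derivative_per (j : nat) (f g : R -> H) : Prop :=
  forall phi : R -> R, smooth_per phi ->
  exists v : H,
    is_bochner `[0, T] (fun t => (derive1n j phi t)%:C *: f t) ((-1) ^+ j *: v) /\
    is_bochner `[0, T] (fun t => (phi t)%:C *: g t) v.

Definition sobolev_per (k : nat) (f : R -> H) : Prop :=
  L2_per f /\
  forall j, (j <= k)%N -> exists2 g, L2_per g & weak_derivative_per j f g.

End PeriodicSobolev.

(* Semigroups are families indexed by R of which only the values at t >= 0
   matter. *)
Section Semigroup.
Variables (R : realType) (H : normedModType R[i]).
Implicit Types (S : R -> {linear H -> H}) (domA : set H) (A : H -> H).

Definition C0_semigroup S : Prop :=
  [/\ forall t, 0 <= t -> continuous (S t),
      forall x, S 0 x = x,
      forall s t x, 0 <= s -> 0 <= t -> S (s + t) x = S s (S t x) &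
      forall x, S t x @[t --> 0^'+] --> x].

Definition uniformly_bounded S : Prop :=
  exists M : R, forall t, 0 <= t -> (opnorm (S t) <= M%:E)%E.

Definition strongly_stable S : Prop :=
  forall x, S t x @[t --> +oo] --> (0 : H).

(* The unbounded operator is (domA, A); A is irrelevant outside domA. *)
Definition is_generator S domA A : Prop :=
  (forall x, domA x <-> cvg ((h^-1)%:C *: (S h x - x) @[h --> 0^'+])) /\
  (forall x, domA x -> (h^-1)%:C *: (S h x - x) @[h --> 0^'+] --> A x).

Definition resolvent domA A (l : R[i]) : H -> H :=
  fun y => xget 0 [set x | domA x /\ l *: x - A x = y].

Definition resolvent_set domA A : set R[i] :=
  [set l | set_bij domA setT (fun x => l *: x - A x) /\
           continuous (resolvent domA A l)].

Definition mild_solution S (f u : R -> H) : Prop :=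
  exists u0 : H, forall t, 0 <= t ->
    is_bochner `[0, t] (fun s => S (t - s) (f s)) (u t - S t u0).

Definition statically_resonant S (T : R) (f : R -> H) : Prop :=
  ~ exists u, mild_solution S f u /\ forall t, 0 <= t -> u (t + T) = u t.

Definition secularly_resonant S (f : R -> H) : Prop :=
  exists u, mild_solution S f u /\
    ereal_sup [set (rnorm (u t))%:E | t in [set t : R | 0 <= t]] = +oo%E.

End Semigroup.

Definition omega (R : realType) (T : R) (n : int) : R := 2 * pi * n%:~R / T.

(* Main.v *)
Require Import Defs.
From HB Require Import structures.
From mathcomp Require Import all_boot all_order all_algebra.
From mathcomp Require Import all_classical all_reals all_analysis.
From mathcomp Require Import measurable_realfun complex finmap ring lra.

(** Resonance is read off at the multiples of the period.  For a T-periodic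
    forcing f, every mild solution satisfies

      u(pT) - S(pT) u0 = I_p,   I_p = int_0^(pT) S(pT - s) f(s) ds,

    and S is bounded.  If the vectors I_p are unbounded in p, then no mild
    solution can be periodic, because a periodic one takes the same value at all
    multiples of T, and the mild solution starting from 0 is itself unbounded
    ([unbounded_static], [unbounded_secular]).  So a single forcing f in the
    Sobolev space of order d = m - 1 with unbounded I_p is all that is wanted,
    and it is built by a gliding hump.

    For one mode f(s) = e^(i theta s) y with i theta x - A x = y, the function
    S(t - s) e^(i theta s) x is a primitive of S(t - s) f(s), whence
    I_p = x - S(pT) x when e^(i theta T) = 1 ([integrates_conv_mode]).  Strong
    stability makes I_p comparable to x for some p ([stable_halves]).  By the
    growth of the resolvent, x can be taken arbitrarily large while the Sobolev
    norm of order d of the mode stays at most 1: the lower bound of order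
    d + 1 exceeds the normalisation (1 + |theta|)^d by a factor 1 + |theta|
    ([large_mode_exists]).  The forcing is a sum of such modes with weights b_n
    chosen one after another ([hump_state]).  The n-th mode is so large that its
    response after p_n periods dominates the responses of the earlier modes,
    which are bounded in p; the later weights are so small compared with 1/p_n
    that the later modes contribute at most a constant up to time p_n T
    ([hump_response]).

    The weights decrease geometrically, so the series of modes and its first d
    termwise derivatives converge uniformly.  Hence only uniformly continuous
    integrands on a compact interval occur, and their Bochner integrals are
    limits of Riemann sums.  Three facts about these carry the proof: the limit
    is the only possible value of the Bochner integral
    ([integrates_bochner_uniq]), it is computed by primitives
    ([primitive_integrates]), and it depends continuously on the integrand for
    uniform convergence ([integrates_norm], [integrates_lim]).  The weak
    derivatives of the forcing are obtained in the same way from the primitive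
    phi(s) e^(i theta s) z ([mode_primitive], [integrates_by_parts]). *)

Set Implicit Arguments.
Unset Strict Implicit.
Unset Printing Implicit Defensive.

Import Order.TTheory GRing.Theory Num.Theory.
Import numFieldNormedType.Exports.

Local Open Scope classical_set_scope.
Local Open Scope complex_scope.
Local Open Scope ring_scope.

(** * The real-valued norm and the real inner product *)

Section RealNorm.
Variables (R : realType) (H : normedModType R[i]).
Implicit Types x y : H.

Lemma rnormE x : `|x| = (rnorm x)%:C.
Proof.
have := normr_ge0 x; rewrite /rnorm; case: (`|x|) => a b.
by rewrite lecE /= => /andP[/eqP-> _].
Qed.

Lemma rnorm_ge0 x : 0 <= rnorm x.
Proof. by rewrite -lecR -rnormE normr_ge0. Qed.

Lemma rnorm0 : rnorm (0 : H) = 0.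
Proof. by rewrite /rnorm normr0. Qed.

Lemma rnorm_eq0 x : rnorm x = 0 -> x = 0.
Proof. by move=> x0; apply/normr0_eq0; rewrite rnormE x0. Qed.

Lemma rnormD x y : rnorm (x + y) <= rnorm x + rnorm y.
Proof. by rewrite -lecR rmorphD /= -!rnormE ler_normD. Qed.

Lemma rnormN x : rnorm (- x) = rnorm x.
Proof. by rewrite /rnorm normrN. Qed.

Lemma rnorm_distC x y : rnorm (x - y) = rnorm (y - x).
Proof. by rewrite /rnorm distrC. Qed.

Lemma rnormB x y : rnorm (x - y) <= rnorm x + rnorm y.
Proof. by rewrite -[leRHS](congr1 (fun r => _ + r) (rnormN y)) rnormD. Qed.

Lemma rnorm_dist_tri z x y : rnorm (x - y) <= rnorm (x - z) + rnorm (z - y).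
Proof. by rewrite -[x - y](subrKA z) rnormD. Qed.

Lemma rnormZ (a : R[i]) x : rnorm (a *: x) = Normc.normc a * rnorm x.
Proof.
apply: (@complexI R); rewrite -rnormE normrZ rnormE rmorphM /=.
by congr (_ * _).
Qed.

Lemma rnormZr (r : R) x : rnorm (r%:C *: x) = `|r| * rnorm x.
Proof. by rewrite rnormZ /= expr0n addr0 sqrtr_sqr. Qed.

Lemma rnorm_sum (I : Type) (r : seq I) (P : pred I) (F : I -> H) :
  rnorm (\sum_(i <- r | P i) F i) <= \sum_(i <- r | P i) rnorm (F i).
Proof.
elim/big_ind2 : _ => [|x a y b xa yb|//]; first by rewrite rnorm0.
by rewrite (le_trans (rnormD _ _))// lerD.
Qed.

Lemma ler_dist_rnorm x y : `|rnorm x - rnorm y| <= rnorm (x - y).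
Proof.
rewrite ler_norml; apply/andP; split; last first.
  by rewrite lerBlDr (le_trans _ (rnormD _ _))// subrK.
by rewrite lerNl opprB rnorm_distC lerBlDr (le_trans _ (rnormD _ _))// subrK.
Qed.

Lemma cvg_rnormP (T : Type) (F : set_system T) {FF : Filter F} (u : T -> H)
    (l : H) :
  u @ F --> l <-> forall e : R, 0 < e -> \forall t \near F, rnorm (u t - l) < e.
Proof.
split=> [/cvgrPdist_lt ul e e0|ul].
  have /ul : 0 < e%:C by rewrite ltcR.
  by apply: filterS => t; rewrite rnormE ltcR rnorm_distC.
apply/cvgrPdist_lt => -[e e']; rewrite ltcE /= => /andP[/eqP-> e0].
by apply: filterS (ul _ e0) => t; rewrite rnormE ltcR rnorm_distC.
Qed.

Lemma cvgn_rnormP (u : nat -> H) (l : H) :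
  u n @[n --> \oo] --> l <->
  forall e : R, 0 < e -> exists N, forall n, (N <= n)%N -> rnorm (u n - l) < e.
Proof.
rewrite cvg_rnormP; split=> ul e /ul.
  by case=> N _ Nul; exists N => n Nn; apply: Nul.
by case=> N Nul; exists N => // n /= Nn; apply: Nul.
Qed.

End RealNorm.

Lemma rnorm_cauchy_cvg (R : realType) (H : completeNormedModType R[i])
    (u : nat -> H) :
  (forall e : R, 0 < e -> exists N, forall n k, (N <= n)%N -> (N <= k)%N ->
    rnorm (u n - u k) < e) ->
  exists l : H, u n @[n --> \oo] --> l.
Proof.
move=> uC; suff uK : cauchy (fmap u \oo).
  by exists (lim (fmap u \oo)); apply: cauchy_cvg.
apply/cauchy_ballP => -[e e']; rewrite ltcE /= => /andP[/eqP-> e0].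
have [N uN] := uC _ e0.
exists (u @` [set n | (N <= n)%N], u @` [set n | (N <= n)%N]) => /=.
  by split; exists N => // n /= Nn; exists n.
move=> [_ _] /= [[n Nn <-] [k Nk <-]].
by rewrite -ball_normE /= rnormE ltcR uN.
Qed.

Section RealInnerProduct.
Variables (R : realType) (H : normedModType R[i]).
Variables (dot : {dot H for Num.conj}).
Hypothesis dotE : forall x : H, `|x| ^+ 2 = dot x x.
Implicit Types x y z : H.

Definition rdot x y : R := complex.Re (dot x y).

Lemma rdotxx x : rdot x x = rnorm x ^+ 2.
Proof. by rewrite /rdot -dotE rnormE -rmorphXn. Qed.

Lemma rdotDl x y z : rdot (x + y) z = rdot x z + rdot y z.
Proof. by rewrite /rdot linearDl raddfD. Qed.

Lemma rdotBl x y z : rdot (x - y) z = rdot x z - rdot y z.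
Proof. by rewrite /rdot linearBl raddfB. Qed.

Lemma rdot0l z : rdot 0 z = 0.
Proof. by rewrite /rdot linear0l. Qed.

Lemma rdotZl (r : R) x z : rdot (r%:C *: x) z = r * rdot x z.
Proof.
by rewrite /rdot linearZl_LR /=; case: (dot x z) => a b /=; rewrite mul0r subr0.
Qed.

Lemma rdot_suml (I : Type) (r : seq I) (P : pred I) (F : I -> H) z :
  rdot (\sum_(i <- r | P i) F i) z = \sum_(i <- r | P i) rdot (F i) z.
Proof.
elim/big_rec2 : _ => [|i a x _ <-]; first by rewrite rdot0l.
by rewrite rdotDl.
Qed.

Lemma rdotC x y : rdot x y = rdot y x.
Proof.
rewrite /rdot (hermC dot) /= expr0 mul1r.
by case: (dot y x).
Qed.

Lemma rdot_le x y : rdot x y <= rnorm x * rnorm y.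
Proof.
have [/rnorm_eq0 ->|y0] := eqVneq (rnorm y) 0.
  by rewrite rdotC rdot0l rnorm0 mulr0.
have {}y0 : 0 < rnorm y by rewrite lt_neqAle eq_sym y0 rnorm_ge0.
have [->|x0] := eqVneq x 0; first by rewrite rdot0l rnorm0 mul0r.
(* the square of the norm of |y| x - |x| y is nonnegative *)
have := sqr_ge0 (rnorm ((rnorm y)%:C *: x - (rnorm x)%:C *: y)).
rewrite -rdotxx rdotBl !rdotZl.
rewrite (rdotC x) (rdotC y) !rdotBl !rdotZl !rdotxx (rdotC y x).
have {}x0 : 0 < rnorm x.
  by rewrite lt_def rnorm_ge0 andbT; apply: contra_neq x0; apply: rnorm_eq0.
move=> h; rewrite -(ler_pM2l (mulr_gt0 x0 y0)).
nra.
Qed.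

End RealInnerProduct.

(** * Functions with finite range *)

Section FiniteRange.
Variables (R : realType) (X : choiceType).
Implicit Types (s : R -> X) (F : X -> R) (D : set R) (r : seq X).
Let mu := @lebesgue_measure R.

(** The codomain is an arbitrary choice type: besides simple functions into H,
    this covers pairs of them and the index of the cell containing a point. *)
Definition finite_range s :=
  finite_set (range s) /\
  forall y, measurable (s @^-1` [set y] : set (measurableTypeR R)).

Lemma finite_rangeE s : finite_range s ->
  exists2 r, uniq r & forall x, s x \in r.
Proof.
move=> [fs _]; exists (fset_set (range s)); first exact: fset_uniq.
by move=> x; rewrite in_fset_set//; apply/mem_set; exists x.
Qed.

Lemma finite_range_decomposition s F r x : uniq r -> s x \in r ->
  F (s x) = \sum_(y <- r) F y * \1_(s @^-1` [set y]) x.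
Proof.
move=> ur rsx; rewrite (bigD1_seq (s x)) //=.
rewrite indicE mem_set// mulr1 big1 ?addr0// => y yx.
rewrite indicE memNset ?mulr0//= => sxy.
by rewrite sxy eqxx in yx.
Qed.

Lemma measurable_finite_range s F D : finite_range s ->
  measurable_fun (D : set (measurableTypeR R)) (F \o s).
Proof.
move=> fs; have [r ur rs] := finite_rangeE fs; case: fs => _ ms.
apply: (measurable_funS measurableT) => //.
rewrite (_ : F \o s = fun x =>
    \sum_(y <- r) F y * \1_(s @^-1` [set y]) x).
  by apply: measurable_sum => y; apply: measurable_funM => //;
     apply: measurable_indic.
by apply/funext => x /=; apply: finite_range_decomposition.
Qed.

Section Integral.
Variable D : set R.
Hypotheses (mD : measurable (D : set (measurableTypeR R))).
Hypotheses (Doo : (mu D < +oo)%E).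

Lemma integrable_finite_range s F : finite_range s ->
  mu.-integrable D (EFin \o (F \o s)).
Proof.
move=> fs; have [r ur rs] := finite_rangeE fs.
apply: measurable_bounded_integrable => //; first exact: measurable_finite_range.
exists (\sum_(y <- r) `|F y|); split; first by rewrite num_real.
move=> b ltb x Dx; apply: le_trans (ltW ltb).
by rewrite /= (bigD1_seq (s x)) //= lerDl sumr_ge0.
Qed.

Lemma integral_finite_range s F r : finite_range s -> uniq r ->
  (forall x, s x \in r) ->
  (\int[mu]_(x in D) (F (s x))%:E)%E =
  (\sum_(y <- r) fine (mu (D `&` s @^-1` [set y])) * F y)%:E.
Proof.
move=> fs ur rs; have [_ ms] := fs.
have mu_fin y : mu (D `&` s @^-1` [set y]) \is a fin_num.
  rewrite ge0_fin_numE//; apply: le_lt_trans Doo; by apply: le_measure => //;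
    apply/mem_set => //; apply: measurableI => //; apply: ms.
have int_indic y : mu.-integrable D (fun x => (\1_(s @^-1` [set y]) x)%:E).
  exact: (integrable_finite_range (\1_[set y]) fs).
under eq_integral.
  move=> x _; rewrite (finite_range_decomposition _ ur (rs x)) -sumEFin.
  under eq_bigr do rewrite EFinM.
  over.
rewrite integral_sum//; last by move=> y; apply: integrableZl.
rewrite -sumEFin; apply: eq_bigr => y _.
rewrite (integralZl mD (int_indic y)) integral_indic//.
by rewrite EFinM fineK// muleC setIC.
Qed.

End Integral.
End FiniteRange.

Lemma finite_range_comp (R : realType) (X Y : choiceType) (s : R -> X)
    (g : X -> Y) : finite_range s -> finite_range (g \o s).
Proof.
move=> fs; have [fin_s _] := fs; split=> [|z].
  by have := finite_image g fin_s; rewrite image_comp.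
rewrite (_ : _ @^-1` _ = setT `&`
    ((fun y => (g y == z)%:R : R) \o s) @^-1` [set 1]).
  by apply: measurable_finite_range.
apply/seteqP; split=> x /=; first by move=> ->; rewrite eqxx.
by case=> _; case: eqP => // _ /eqP; rewrite eq_sym oner_eq0.
Qed.

Lemma finite_range_pair (R : realType) (X Y : choiceType) (s : R -> X)
    (r : R -> Y) : finite_range s -> finite_range r ->
  finite_range (fun x => (s x, r x)).
Proof.
move=> [fs ms] [fr mr]; split=> [|[a b]].
  apply: (@sub_finite_set _ _ (range s `*` range r)); last exact: finite_setX.
  by move=> _ [x _ <-]; split => /=; exists x.
rewrite (_ : _ @^-1` _ = s @^-1` [set a] `&` r @^-1` [set b]).
  exact: measurableI.
by apply/seteqP; split=> x /= => [[-> ->]|[-> ->]].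
Qed.

Section SimpleIntegral.
Variables (R : realType) (H : normedModType R[i]).
Variables (dot : {dot H for Num.conj}).
Hypothesis dotE : forall x : H, `|x| ^+ 2 = dot x x.
Let mu := @lebesgue_measure R.
Variable D : set R.
Hypotheses (mD : measurable (D : set (measurableTypeR R))).
Hypotheses (Doo : (mu D < +oo)%E).
Implicit Types r s : R -> H.

Lemma simple_on_finite_range s : simple_on D s -> finite_range s.
Proof. by case=> fs ms _; split. Qed.

Lemma finite_range_simple_on s : finite_range s -> simple_on D s.
Proof.
move=> [fs ms]; split=> // y _.
by apply: le_lt_trans Doo; apply: le_measure => //;
  apply/mem_set => //; apply: measurableI => //; apply: ms.
Qed.

Lemma rdot_simple_integral s z : finite_range s ->
  (\int[mu]_(x in D) (rdot dot (s x) z)%:E)%E =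
  (rdot dot (simple_integral D s) z)%:E.
Proof.
move=> fs; rewrite (integral_finite_range mD Doo (rdot dot ^~ z) fs
    (fset_uniq (fset_set (range s)))); last first.
  by move=> x; case: fs => fs _; rewrite in_fset_set//; apply/mem_set; exists x.
rewrite /simple_integral fsbig_finite /=; last by case: fs.
rewrite rdot_suml; congr (_ %:E); apply: eq_bigr => y _.
by rewrite rdotZl.
Qed.

(** Testing the difference z of the two integrals against z itself reduces the
    bound to real integrals and the Cauchy-Schwarz inequality. *)
Lemma simple_integral_dist r s : finite_range r -> finite_range s ->
  ((rnorm (simple_integral D r - simple_integral D s))%:E <=
   \int[mu]_(x in D) (rnorm (r x - s x))%:E)%E.
Proof.
move=> fr fs; set z := _ - _; have frs := finite_range_pair fr fs.
have iN := integrable_finite_range mD Doo (fun p : H * H => rnorm (p.1 - p.2)) frs.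
have id := integrable_finite_range mD Doo
  (fun p : H * H => rdot dot (p.1 - p.2) z) frs.
have ir := integrable_finite_range mD Doo (rdot dot ^~ z) fr.
have i_s := integrable_finite_range mD Doo (rdot dot ^~ z) fs.
have zE : ((rnorm z ^+ 2)%:E <=
    (rnorm z)%:E * \int[mu]_(x in D) (rnorm (r x - s x))%:E)%E.
  rewrite -(rdotxx dotE) {1}/z rdotBl EFinB -!rdot_simple_integral//.
  rewrite -integralB// -integralZl//; apply: le_integral => //.
  - exact: integrableB.
  - exact: integrableZl.
  by move=> x _; rewrite -EFinB -EFinM lee_fin -rdotBl mulrC rdot_le.
have [->|z0] := eqVneq (rnorm z) 0.
  by apply: integral_ge0 => x _; rewrite lee_fin rnorm_ge0.
have {}z0 : 0 < rnorm z by rewrite lt_def z0 rnorm_ge0.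
by rewrite -(@lee_pmul2l _ (rnorm z)%:E)// -EFinM.
Qed.

End SimpleIntegral.

(** * Uniform grids *)

Section Grid.
Variables (R : realType) (t : R) (n : nat).
Hypothesis t0 : 0 <= t.
Let mu := @lebesgue_measure R.

Definition mesh : R := t / n.+1%:R.

Definition in_cell (x : R) (i : 'I_n.+1) : bool :=
  (mesh * i%:R < x) && (x <= mesh * i.+1%:R).

(** The default value puts the left end 0, which lies in no half-open cell, into
    the first one; points outside of ]0, t] also get index 0. *)
Definition cell_index (x : R) : 'I_n.+1 := odflt ord0 [pick i | in_cell x i].

Definition right_node (i : 'I_n.+1) : R := mesh * i.+1%:R.

Lemma mesh_ge0 : 0 <= mesh.
Proof. by rewrite divr_ge0. Qed.

Lemma meshE : mesh * n.+1%:R = t.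
Proof. by rewrite /mesh divfK// pnatr_eq0. Qed.

Lemma right_node_le i : right_node i <= t.
Proof. by rewrite -[leRHS]meshE ler_wpM2l ?mesh_ge0// ler_nat. Qed.

Lemma right_node_ge0 i : 0 <= right_node i.
Proof. by rewrite mulr_ge0 ?mesh_ge0. Qed.

Lemma in_cell_uniq x i j : in_cell x i -> in_cell x j -> i = j.
Proof.
wlog ij : i j / (i <= j)%N => [hw xi xj|/andP[_ xi] /andP[xj _]].
  by case/orP: (leq_total i j) => /hw; [exact|move/(_ xj xi)].
apply/val_inj/eqP; rewrite eqn_leq ij leqNgt /=; apply/negP => ji.
have := lt_le_trans xj xi; rewrite ltNge ler_wpM2l ?mesh_ge0// ler_nat //.
Qed.

Lemma in_cell_exists x : 0 < x -> x <= t -> exists i, in_cell x i.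
Proof.
move=> x0 xt; pose P i := x <= mesh * i.+1%:R.
have exP : exists i, P i by exists n; rewrite /P meshE.
case: (ex_minnP exP) => i Pi imin.
have ilt : (i < n.+1)%N by rewrite ltnS; apply: imin; rewrite /P meshE.
exists (Ordinal ilt); rewrite /in_cell /= [X in _ && X]Pi andbT.
case: i Pi imin {ilt} => [_ _|i Pi imin]; first by rewrite mulr0.
by rewrite ltNge; apply/negP => /imin; rewrite ltnn.
Qed.

Lemma in_cellP x i : in_cell x i -> cell_index x = i.
Proof.
rewrite /cell_index; case: pickP => [j xj|xN] xi /=; last by rewrite xN in xi.
exact: in_cell_uniq xj xi.
Qed.

Lemma cell_index_neq0 x i : i != ord0 -> cell_index x = i -> in_cell x i.
Proof.
by rewrite /cell_index; case: pickP => [j xj|_] i0 /= ji;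
  [rewrite -ji|rewrite -ji eqxx in i0].
Qed.

Lemma right_node_index x : 0 <= x -> x <= t ->
  x <= right_node (cell_index x) <= x + mesh.
Proof.
move=> x0 xt; rewrite /right_node /cell_index.
case: pickP => [j /andP[xj ->] /=|xN].
  by rewrite -natr1 mulrDr mulr1 lerD2r ltW.
have -> : x = 0.
  apply/eqP; rewrite eq_le x0 andbT leNgt; apply/negP => xp.
  by have [j] := in_cell_exists xp xt; rewrite xN.
by rewrite mulr1 add0r lexx mesh_ge0.
Qed.

Lemma cell_index_preimage i : cell_index @^-1` [set i] =
  if i == ord0 then ~` `]mesh, t]%classic
  else `]mesh * i%:R, mesh * i.+1%:R]%classic.
Proof.
apply/seteqP; split=> x /=; case: eqVneq => [->|i0].
- move=> x0; rewrite /= in_itv /= => /andP[xm xt].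
  have [|j xj] := in_cell_exists _ xt; first exact: le_lt_trans mesh_ge0 xm.
  move: (xj); rewrite -(in_cellP xj) x0 => /andP[_] /=.
  by rewrite mulr1 leNgt xm.
- by move=> /(cell_index_neq0 i0); rewrite /= in_itv.
- rewrite /= in_itv /= => /negP xN; apply/eqP; apply: contraNT xN => j0.
  have /andP[xj jx] := cell_index_neq0 j0 erefl.
  rewrite (le_trans jx (right_node_le _)) andbT (le_lt_trans _ xj)//.
  by rewrite -[leLHS]mulr1 ler_wpM2l ?mesh_ge0// ler1n lt0n.
- by rewrite /= in_itv => xi; apply: in_cellP.
Qed.

Lemma finite_range_cell_index : finite_range cell_index.
Proof.
split=> [|i]; first exact: finite_finset.
rewrite cell_index_preimage; case: ifP => _ //.
by apply: measurableC.
Qed.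

Lemma measure_cell i : mu (`[0, t] `&` cell_index @^-1` [set i]) = mesh%:E.
Proof.
move: t0; rewrite le_eqVlt => /predU1P[t_0|tp].
  have m0 : mesh = 0 by rewrite /mesh -t_0 mul0r.
  apply/eqP; rewrite m0 eq_le measure_ge0 andbT.
  have -> : 0%:E = mu `[0, t] by rewrite -t_0 set_itv1 /mu lebesgue_measure_set1.
  apply: le_measure => //; apply/mem_set => //.
  by apply: measurableI => //; apply: finite_range_cell_index.2.
have mp : 0 < mesh by rewrite divr_gt0.
have mt : mesh <= t.
  by rewrite -[leRHS]meshE -[leLHS]mulr1 ler_wpM2l ?mesh_ge0// ler1n.
rewrite cell_index_preimage; case: eqVneq => [_|i0].
  rewrite (_ : _ `&` _ = `[0, mesh]%classic).
    by rewrite /mu lebesgue_measure_itv /= lte_fin mp oppr0 adde0.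
  apply/seteqP; split=> x /=; rewrite !in_itv /=.
    by move=> [/andP[-> xt]] /negP; rewrite xt andbT -leNgt.
  move=> /andP[x0 xm]; rewrite x0 (le_trans xm mt); split=> //.
  by apply/negP; rewrite negb_and -leNgt xm.
rewrite (_ : _ `&` _ = `]mesh * i%:R, mesh * i.+1%:R]%classic).
  rewrite /mu lebesgue_measure_itv /= lte_fin ltr_pM2l// ltr_nat leqnn.
  by rewrite -EFinB -mulrBr -natrB// subSnn mulr1.
apply/seteqP; split=> x /=; rewrite !in_itv /=; first by case.
move=> /andP[ix xi]; split; last by rewrite ix xi.
rewrite (le_trans xi (right_node_le _)) (le_trans _ (ltW ix))//.
by rewrite mulr_ge0 ?mesh_ge0.
Qed.

End Grid.

(** * Riemann sums and step functions *)

Lemma ge0_cvge0P (R : realType) (u : nat -> \bar R) :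
  (forall n, (0 <= u n)%E) ->
  u n @[n --> \oo] --> 0%E <->
  forall e : R, 0 < e -> exists N, forall n, (N <= n)%N -> (u n < e%:E)%E.
Proof.
move=> u0; split=> [/fine_cvgP[ufin /cvgrPdist_lt ul] e e0|ul].
  have [N _ NP] := filterI ufin (ul _ e0).
  exists N => n /NP[un]; rewrite /= sub0r normrN ger0_norm ?fine_ge0//.
  by rewrite -lte_fin fineK.
have ufin e n : (u n < e%:E)%E -> u n \is a fin_num.
  by move=> une; rewrite ge0_fin_numE// (lt_trans une)// ltry.
apply/fine_cvgP; split.
  by have [N Nu] := ul _ ltr01; exists N => // n /= /Nu; apply: ufin.
apply/cvgrPdist_lt => e e0; have [N Nu] := ul _ e0.
exists N => // n /= /Nu une; rewrite sub0r normrN ger0_norm ?fine_ge0//.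
by rewrite -lte_fin fineK// (ufin e).
Qed.

Section RiemannSums.
Variables (R : realType) (H : normedModType R[i]).
Let mu := @lebesgue_measure R.
Variable t : R.
Hypothesis t0 : 0 <= t.
Implicit Types (phi psi : R -> H) (s : R -> H).

Definition unif_cont phi : Prop :=
  forall e : R, 0 < e -> exists2 d : R, 0 < d &
    forall x y, 0 <= x -> x <= y -> y <= t -> y - x <= d ->
      rnorm (phi y - phi x) <= e.

Definition step phi (n : nat) (x : R) : H :=
  phi (right_node t (cell_index t n x)).

Definition riemann_sum phi (n : nat) : H :=
  (mesh t n)%:C *: \sum_(i < n.+1) phi (right_node t i).

Lemma finite_range_step phi n : finite_range (step phi n).
Proof.
apply: (@finite_range_comp R 'I_n.+1 H (cell_index t n) (phi \o @right_node R t n)).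
exact: finite_range_cell_index.
Qed.

Lemma mesh_small (e : R) : 0 < e ->
  exists N, forall n, (N <= n)%N -> mesh t n <= e.
Proof.
move=> e0; exists (Num.truncn (t / e)) => n Nn.
rewrite /mesh ler_pdivrMr// mulrC -ler_pdivrMr// ltW//.
apply: lt_le_trans (truncnS_gt _) _.
by rewrite ler_nat ltnS.
Qed.

Lemma step_unif phi : unif_cont phi -> forall e, 0 < e -> exists N,
  forall n x, (N <= n)%N -> 0 <= x -> x <= t -> rnorm (phi x - step phi n x) <= e.
Proof.
move=> phiC e e0; have [d d0 phid] := phiC _ e0.
have [N meshN] := mesh_small d0; exists N => n x /meshN md x0 xt.
have /andP[xl xr] := right_node_index n t0 x0 xt.
rewrite rnorm_distC phid// ?right_node_le//.
by rewrite lerBlDl (le_trans xr)// lerD2l.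
Qed.

Lemma measure_itv0 : mu `[0, t] = t%:E.
Proof.
rewrite /mu lebesgue_measure_itv /= lte_fin oppr0 adde0.
by move: t0; rewrite le_eqVlt => /predU1P[<-|->//]; rewrite ltxx.
Qed.

Lemma measure_itv0_fin : (mu `[0%R, t] < +oo)%E.
Proof. by rewrite measure_itv0 ltry. Qed.

Lemma measurable_rnormB phi s : unif_cont phi -> finite_range s ->
  measurable_fun (`[0, t]%classic : set (measurableTypeR R))
    (fun x => rnorm (phi x - s x)).
Proof.
move=> phiC fs.
apply: (@measurable_fun_cvg _ _ _ _ (fun n x => rnorm (step phi n x - s x))).
  move=> n; have fp := finite_range_pair (finite_range_step phi n) fs.
  exact: (measurable_finite_range (fun p : H * H => rnorm (p.1 - p.2)) fp).
move=> x /=; rewrite in_itv /= => /andP[x0 xt].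
apply/cvgrPdist_lt => e e0.
have [N NP] := step_unif phiC (divr_gt0 e0 (ltr0n R 2)).
exists N => // n /= Nn; apply: (@le_lt_trans _ _ (e / 2)); last first.
  by rewrite ltr_pdivrMr// ltr_pMr// ltr1n.
apply: le_trans (ler_dist_rnorm _ _) _.
by rewrite opprB addrA subrK; apply: NP.
Qed.

Lemma measurable_rnorm phi : unif_cont phi ->
  measurable_fun (`[0, t]%classic : set (measurableTypeR R))
    (fun x => rnorm (phi x)).
Proof.
move=> phiC; have f0 : finite_range (fun _ : R => 0 : H).
  exact: (finite_range_comp (fun=> 0) (finite_range_cell_index 0 t0)).
apply: eq_measurable_fun (measurable_rnormB phiC f0).
by move=> x _; rewrite subr0.
Qed.

Lemma integral_itv0_le (g : R -> R) (e : R) :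
  measurable_fun (`[0, t]%classic : set (measurableTypeR R)) g -> 0 <= e ->
  (forall x, 0 <= x -> x <= t -> 0 <= g x <= e) ->
  (\int[mu]_(x in `[0%R, t]) (g x)%:E <= (e * t)%:E)%E.
Proof.
move=> mg e0 ge.
have -> : ((e * t)%:E = \int[mu]_(x in `[0%R, t]) (cst e%:E) x)%E.
  by rewrite integral_cst//= -/mu measure_itv0 EFinM.
apply: ge0_le_integral => //=.
- by move=> x; rewrite in_itv /= => /andP[x0 xt]; have /andP[] := ge _ x0 xt.
- by apply/measurable_EFinP.
- move=> x; rewrite in_itv /= => /andP[x0 xt].
  by rewrite lee_fin; have /andP[] := ge _ x0 xt.
Qed.

Lemma step_cvg_L1 phi : unif_cont phi ->
  (\int[mu]_(x in `[0%R, t]) (rnorm (phi x - step phi n x))%:E)%E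
    @[n --> \oo] --> 0%E.
Proof.
move=> phiC; apply/ge0_cvge0P => [n|e e0].
  by apply: integral_ge0 => x _; rewrite lee_fin rnorm_ge0.
have d0 : 0 < e / (t + 1) by rewrite divr_gt0// ltr_wpDl.
have [N NP] := step_unif phiC d0; exists N => n Nn.
apply: (@le_lt_trans _ _ (e / (t + 1) * t)%:E).
  apply: integral_itv0_le; [|exact: ltW|].
    exact: measurable_rnormB phiC (finite_range_step _ _).
  by move=> x x0 xt; rewrite rnorm_ge0 NP.
rewrite lte_fin mulrAC ltr_pdivrMr ?ltr_wpDl//.
by rewrite ltr_pM2l// ltrDl.
Qed.

End RiemannSums.

(** * Integration of uniformly continuous functions *)

Section RegularIntegral.
Variables (R : realType) (H : completeNormedModType R[i]).
Variables (dot : {dot H for Num.conj}).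
Hypothesis dotE : forall x : H, `|x| ^+ 2 = dot x x.
Let mu := @lebesgue_measure R.
Variable t : R.
Hypothesis t0 : 0 <= t.
Implicit Types (phi psi : R -> H) (s : R -> H).

Let mD : measurable (`[0, t]%classic : set (measurableTypeR R)).
Proof. exact: measurable_itv. Qed.

Let Doo := measure_itv0_fin t0.

(** Each cell of the grid has measure equal to the mesh; testing against the
    difference of the two sides avoids collecting the cells by values of
    phi. *)
Lemma simple_integral_step phi n :
  simple_integral `[0, t] (step t phi n) = riemann_sum t phi n.
Proof.
apply/eqP; rewrite -subr_eq0; apply/eqP; set z := _ - _.
apply: rnorm_eq0; apply/eqP; rewrite -sqrf_eq0 -(rdotxx dotE).
rewrite {1}/z rdotBl subr_eq0; apply/eqP/EFin_inj.
rewrite -(rdot_simple_integral dot mD Doo z (finite_range_step t0 phi n)).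
rewrite (integral_finite_range mD Doo
  (fun i => rdot dot (phi (right_node t i)) z)
  (finite_range_cell_index n t0) (index_enum_uniq _)); last first.
  by move=> x; apply: mem_index_enum.
rewrite /riemann_sum rdotZl rdot_suml big_distrr /=; congr (_ %:E).
by apply: eq_bigr => i _; rewrite measure_cell.
Qed.

(** The value is pinned down by Riemann sums, which are linear in the integrand
    and visibly telescope for derivatives. *)
Definition integrates phi (v : H) : Prop :=
  unif_cont t phi /\ riemann_sum t phi n @[n --> \oo] --> v.

Lemma step_cvg phi x : unif_cont t phi -> 0 <= x -> x <= t ->
  step t phi n x @[n --> \oo] --> phi x.
Proof.
move=> phiC x0 xt; apply/cvgn_rnormP => e e0.
have [N NP] := step_unif t0 phiC (divr_gt0 e0 (ltr0n R 2)).
exists N => n Nn; rewrite rnorm_distC; apply: le_lt_trans (NP _ _ Nn x0 xt) _.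
by rewrite ltr_pdivrMr// ltr_pMr// ltr1n.
Qed.

Lemma strongly_measurable_step phi : unif_cont t phi ->
  strongly_measurable_by `[0, t] phi (step t phi).
Proof.
move=> phiC; split.
  by move=> n; apply: finite_range_simple_on => //; apply: finite_range_step.
by apply: aeW => x; rewrite /= in_itv /= => /andP[x0 xt]; apply: step_cvg.
Qed.

Lemma integrates_bochner phi v : integrates phi v ->
  is_bochner `[0, t] phi v.
Proof.
move=> [phiC phiv]; exists (step t phi); split.
- exact: strongly_measurable_step.
- exact: step_cvg_L1.
- by under eq_fun do rewrite simple_integral_step.
Qed.

Lemma integrates_exists phi : unif_cont t phi -> exists v, integrates phi v.
Proof.
move=> phiC; suff [v phiv] : exists v : H, riemann_sum t phi n @[n --> \oo] --> v.
  by exists v.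
apply: rnorm_cauchy_cvg => e e0.
have d0 : 0 < e / (t + 1) / 2 by rewrite !divr_gt0// ltr_wpDl.
have [N NP] := step_unif t0 phiC d0; exists N => n k Nn Nk.
rewrite -lte_fin -!simple_integral_step.
have fp :=
  finite_range_pair (finite_range_step t0 phi n) (finite_range_step t0 phi k).
apply: le_lt_trans (simple_integral_dist dotE mD Doo _ _) _;
  try exact: finite_range_step.
apply: (@le_lt_trans _ _ (e / (t + 1) * t)%:E).
  apply: integral_itv0_le => //.
  - exact: (measurable_finite_range (fun p : H * H => rnorm (p.1 - p.2)) fp).
  - by rewrite ltW// divr_gt0// ltr_wpDl.
  move=> x x0 xt; rewrite rnorm_ge0 /=.
  apply: le_trans (rnorm_dist_tri (phi x) _ _) _.
  rewrite [leRHS]splitr lerD//; last exact: NP.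
  by rewrite rnorm_distC; exact: NP.
rewrite lte_fin mulrAC ltr_pdivrMr ?ltr_wpDl//.
by rewrite ltr_pM2l// ltrDl.
Qed.

(** Two approximating sequences of the same integrand are close in mean, hence
    so are their integrals. *)
Lemma integrates_bochner_uniq phi v w : integrates phi v ->
  is_bochner `[0, t] phi w -> w = v.
Proof.
move=> [phiC phiv] [s [[s_simple _] sphi sw]].
have fs n := simple_on_finite_range (s_simple n).
apply/eqP; rewrite -subr_eq0; apply/eqP/rnorm_eq0/eqP.
rewrite eq_le rnorm_ge0 andbT; apply/ler_addgt0Pr => e e0; rewrite add0r.
have d0 : 0 < e / 4%:R by rewrite divr_gt0.
have int_ge0 (f : R -> H) : (0 <= \int[mu]_(x in `[0%R, t]) (rnorm (f x))%:E)%E.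
  by apply: integral_ge0 => x _; rewrite lee_fin rnorm_ge0.
have [N1 NP1] := (cvgn_rnormP _ _).1 phiv _ d0.
have [N2 NP2] := (cvgn_rnormP _ _).1 sw _ d0.
have [N3 NP3] := (ge0_cvge0P (fun n => int_ge0 _)).1 (step_cvg_L1 t0 phiC) _ d0.
have [N4 NP4] := (ge0_cvge0P (fun n => int_ge0 _)).1 sphi _ d0.
pose n := maxn (maxn N1 N2) (maxn N3 N4).
have {}NP1 := NP1 n; have {}NP2 := NP2 n; have {}NP3 := NP3 n; have {}NP4 := NP4 n.
rewrite /n !leq_max !leqnn ?orbT /= in NP1 NP2 NP3 NP4.
have {}NP1 := NP1 erefl; have {}NP2 := NP2 erefl.
have {}NP3 := NP3 erefl; have {}NP4 := NP4 erefl.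
have close : rnorm (simple_integral `[0, t] (s n) - riemann_sum t phi n) < e / 2.
  rewrite -lte_fin -simple_integral_step.
  apply: le_lt_trans (simple_integral_dist dotE mD Doo _ _) _ => //.
    exact: finite_range_step.
  apply: (@le_lt_trans _ _ (\int[mu]_(x in `[0%R, t])
     ((rnorm (phi x - s n x))%:E + (rnorm (phi x - step t phi n x))%:E)))%E.
    apply: ge0_le_integral => //.
    - by move=> x _; rewrite lee_fin rnorm_ge0.
    - apply/measurable_EFinP.
      have fp := finite_range_pair (fs n) (finite_range_step t0 phi n).
      exact: (measurable_finite_range (fun p : H * H => rnorm (p.1 - p.2)) fp).
    - by apply: emeasurable_funD; apply/measurable_EFinP;
        apply: measurable_rnormB => //; apply: finite_range_step.
    - move=> x _; rewrite -EFinD lee_fin.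
      by rewrite [in leRHS]rnorm_distC rnorm_dist_tri.
  rewrite ge0_integralD//=; last 4 first.
  - by move=> x _; rewrite lee_fin rnorm_ge0.
  - by apply/measurable_EFinP; apply: measurable_rnormB.
  - by move=> x _; rewrite lee_fin rnorm_ge0.
  - apply/measurable_EFinP; apply: measurable_rnormB => //.
    exact: finite_range_step.
  rewrite (_ : e / 2 = e / 4%:R + e / 4%:R); last by field.
  by rewrite EFinD lteD.
apply: le_trans (rnorm_dist_tri (simple_integral `[0, t] (s n)) _ _) _.
rewrite rnorm_distC.
have := rnorm_dist_tri (riemann_sum t phi n) (simple_integral `[0, t] (s n)) v.
rewrite -/n in NP1 NP2; lra.
Qed.

Lemma integrates_norm phi v C : integrates phi v ->
  (forall x, 0 <= x -> x <= t -> rnorm (phi x) <= C) -> rnorm v <= t * C.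
Proof.
move=> [_ phiv] phiC; apply/ler_addgt0Pr => e e0.
have [N NP] := (cvgn_rnormP _ _).1 phiv _ e0.
have {}NP := ltW (NP N (leqnn _)).
rewrite -[v](subrK (riemann_sum t phi N)) addrC.
apply: le_trans (rnormD _ _) _; apply: lerD; last by rewrite rnorm_distC.
rewrite /riemann_sum rnormZr ger0_norm ?mesh_ge0//.
have -> : t * C = mesh t N * (N.+1%:R * C) by rewrite mulrA meshE.
rewrite ler_wpM2l ?mesh_ge0//.
apply: le_trans (rnorm_sum _ _ _) _.
rewrite -[X in _ <= X%:R * C]card_ord mulrC mulr_natr -sumr_const.
by apply: ler_sum => i _; rewrite phiC ?right_node_le ?right_node_ge0.
Qed.

Lemma integrates_uniq phi v w : integrates phi v -> integrates phi w -> v = w.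
Proof.
by move=> /integrates_bochner pv pw; apply: integrates_bochner_uniq pw pv.
Qed.

Lemma unif_contD phi psi : unif_cont t phi -> unif_cont t psi ->
  unif_cont t (fun x => phi x + psi x).
Proof.
move=> phiC psiC e e0; have e2 : 0 < e / 2 by rewrite divr_gt0.
have [d d0 dP] := phiC _ e2; have [d' d'0 d'P] := psiC _ e2.
exists (Num.min d d'); first by rewrite lt_min d0.
move=> x y x0 xy yt; rewrite le_min => /andP[yd yd'].
rewrite opprD addrACA [leRHS]splitr; apply: le_trans (rnormD _ _) _.
by rewrite lerD ?dP ?d'P.
Qed.

Lemma unif_contZ (a : R[i]) phi : unif_cont t phi ->
  unif_cont t (fun x => a *: phi x).
Proof.
move=> phiC e e0; have a0 : 0 <= Normc.normc a.
  by case: a => a b /=; apply: sqrtr_ge0.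
have [|d d0 dP] := phiC (e / (Normc.normc a + 1)).
  by rewrite divr_gt0// ltr_wpDl.
exists d => // x y x0 xy yt yd; rewrite -scalerBr rnormZ.
apply: le_trans (ler_wpM2l a0 (dP _ _ x0 xy yt yd)) _.
rewrite mulrC mulrAC ler_pdivrMr ?ltr_wpDl//.
by rewrite ler_wpM2l ?lerDl// ltW.
Qed.

Lemma integratesD phi psi v w : integrates phi v -> integrates psi w ->
  integrates (fun x => phi x + psi x) (v + w).
Proof.
move=> [phiC phiv] [psiC psiw]; split; first exact: unif_contD.
rewrite [X in X @ _ --> _](_ : _ = riemann_sum t phi \+ riemann_sum t psi).
  exact: cvgD.
by apply/funext => n; rewrite /= /riemann_sum -scalerDr big_split.
Qed.

Lemma integratesZ (a : R[i]) phi v : integrates phi v ->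
  integrates (fun x => a *: phi x) (a *: v).
Proof.
move=> [phiC phiv]; split; first exact: unif_contZ.
rewrite [X in X @ _ --> _](_ : _ = fun n => a *: riemann_sum t phi n).
  by apply: cvgZ => //; apply: cvg_cst.
apply/funext => n; by rewrite /riemann_sum -scaler_sumr !scalerA mulrC.
Qed.

Lemma integratesB phi psi v w : integrates phi v -> integrates psi w ->
  integrates (fun x => phi x - psi x) (v - w).
Proof.
move=> pv pw; rewrite -[- w]scaleN1r; under eq_fun do rewrite -[- psi _]scaleN1r.
exact: integratesD pv (integratesZ _ pw).
Qed.

(** The derivative is sampled at the right end y.  If G(s) = S(t - s) v(s) for
    a semigroup S, then S(t - y) factors out of the increment over [x, y] and
    leaves an expression in S(y - x) alone, so that the right derivative of S at
    0 controls the error uniformly. *)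
Definition primitive (G g : R -> H) : Prop :=
  forall e : R, 0 < e -> exists2 d : R, 0 < d &
    forall x y, 0 <= x -> x <= y -> y <= t -> y - x <= d ->
      rnorm (G y - G x - (y - x)%:C *: g y) <= e * (y - x).

Lemma primitive_integrates G g : unif_cont t g -> primitive G g ->
  integrates g (G t - G 0).
Proof.
move=> gC Gg; split=> //; apply/cvgn_rnormP => e e0.
have d0 : 0 < e / (t + 1) by rewrite divr_gt0// ltr_wpDl.
have [d dp dP] := Gg _ d0; have [N NP] := mesh_small t dp.
exists N => n /NP nd; apply: (@le_lt_trans _ _ (e / (t + 1) * t)); last first.
  by rewrite mulrAC ltr_pdivrMr ?ltr_wpDl// ltr_pM2l// ltrDl.
pose F (i : nat) := G (mesh t n * i%:R).
have -> : G t - G 0 = \sum_(i < n.+1) (F i.+1 - F i).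
  rewrite -(big_mkord xpredT (fun i => F i.+1 - F i)) telescope_sumr//.
  by rewrite /F meshE mulr0.
rewrite /riemann_sum scaler_sumr -sumrB -[X in _ * X](meshE t n).
rewrite mulrA; apply: le_trans (rnorm_sum _ _ _) _.
rewrite -[X in _ <= _ * X%:R]card_ord mulr_natr -sumr_const.
apply: ler_sum => i _; rewrite rnorm_distC.
have meshS : mesh t n * i.+1%:R - mesh t n * i%:R = mesh t n.
  by rewrite -mulrBr -natrB// subSnn mulr1.
have := dP (mesh t n * i%:R) (mesh t n * i.+1%:R); rewrite meshS; apply=> //.
- by rewrite mulr_ge0 ?mesh_ge0.
- by rewrite ler_wpM2l ?mesh_ge0// ler_nat.
- exact: right_node_le.
Qed.

End RegularIntegral.

(** * Elementary bounds and the unit circle *)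

Section MeanValueBounds.
Variable R : realType.
Implicit Types f df : R -> R.

Lemma derive_le_dist f df (x y K : R) : x <= y ->
  (forall z : R, is_derive z 1 f (df z)) ->
  (forall z, x <= z -> z <= y -> `|df z| <= K) ->
  `|f y - f x| <= K * (y - x).
Proof.
move=> xy fdf dfK.
have [|c] := MVT_segment xy (fun z _ => fdf z).
  apply/continuous_subspaceT => z; apply: differentiable_continuous.
  by apply/derivable1_diffP; case: (fdf z).
rewrite in_itv /= => /andP[xc cy] ->.
by rewrite normrM [X in _ * X]ger0_norm ?subr_ge0// ler_wpM2r ?subr_ge0// dfK.
Qed.

Lemma derive_le_dist0 f df (a K : R) :
  (forall z : R, is_derive z 1 f (df z)) ->
  (forall z, `|z| <= `|a| -> `|df z| <= K) -> `|f a - f 0| <= K * `|a|.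
Proof.
move=> fdf dfK; have [a0|a0] := leP 0 a.
  rewrite -[X in K * `|X|]subr0 [in leRHS]ger0_norm ?subr0//.
  rewrite -[X in K * X]subr0; apply: derive_le_dist fdf _ => // z z0 za.
  by apply: dfK; rewrite !ger0_norm.
rewrite distrC [in leRHS]ltr0_norm// -[- a]sub0r.
apply: (derive_le_dist (ltW a0) fdf) => z za z0.
by apply: dfK; rewrite (ltr0_norm a0) (ler0_norm z0) lerN2.
Qed.

Lemma norm_sin_le (a : R) : `|sin a| <= `|a|.
Proof.
rewrite -[sin a]subr0 -sin0 -[leRHS]mul1r.
by apply: (derive_le_dist0 (df := cos)) => z _; rewrite cos_max.
Qed.

Lemma norm_cosB1_le (a : R) : `|cos a - 1| <= a ^+ 2.
Proof.
rewrite -[in X in _ - X]cos0 -real_normK ?num_real// expr2.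
apply: (derive_le_dist0 (df := fun z => - sin z)) => z.
by move=> za; rewrite normrN; apply: le_trans (norm_sin_le _) za.
Qed.

Lemma norm_cosB1_le1 (a : R) : `|cos a - 1| <= `|a|.
Proof.
rewrite -[in X in _ - X]cos0 -[leRHS]mul1r.
apply: (derive_le_dist0 (df := fun z => - sin z)) => z.
by move=> _; rewrite normrN sin_max.
Qed.

Lemma norm_sinBid_le (a : R) : `|sin a - a| <= a ^+ 2.
Proof.
have -> : sin a - a = (sin a - a) - (sin 0 - 0) by rewrite sin0 !subr0.
rewrite -real_normK ?num_real// expr2.
apply: (derive_le_dist0 (f := fun z => sin z - z) (df := fun z => cos z - 1)) => z.
by move=> za; apply: le_trans (norm_cosB1_le1 _) za.
Qed.

End MeanValueBounds.

Section UnitCircle.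
Variable R : realType.
Implicit Types a b : R.
Local Notation normc := Normc.normc.

Definition cis a : R[i] := cos a +i* sin a.

Lemma cis0 : cis 0 = 1.
Proof. by rewrite /cis cos0 sin0. Qed.

Lemma cisD a b : cis (a + b) = cis a * cis b.
Proof.
apply/eqP; rewrite /cis cosD sinD eq_complex /= eqxx /=.
by rewrite addrC [X in _ + X]mulrC [X in X + _]mulrC mulrC eqxx.
Qed.

Lemma normc_cis a : normc (cis a) = 1.
Proof. by rewrite /= cos2Dsin2 sqrtr1. Qed.

Lemma normc_le (z : R[i]) : normc z <= `|complex.Re z| + `|complex.Im z|.
Proof.
case: z => x y /=; have h : 0 <= `|x| + `|y| by rewrite addr_ge0.
rewrite -[leRHS](ger0_norm h) -sqrtr_sqr ler_wsqrtr//.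
by rewrite sqrrD !real_normK ?num_real// addrAC lerDl mulrn_wge0// mulr_ge0.
Qed.

Lemma normc_cisB1 a : normc (cis a - 1) <= `|a| *+ 2.
Proof.
apply: le_trans (normc_le _) _; rewrite /= oppr0 addr0 mulr2n.
by rewrite lerD ?norm_cosB1_le1 ?norm_sin_le.
Qed.

Lemma normc_cis_taylor a : normc (cis a - 1 - 0 +i* a) <= a ^+ 2 *+ 2.
Proof.
apply: le_trans (normc_le _) _; rewrite /= oppr0 !addr0 mulr2n.
by rewrite lerD ?norm_cosB1_le ?norm_sinBid_le.
Qed.

Lemma cis2pi (n : int) : cis (2 * pi * n%:~R) = 1.
Proof.
have nat_case (k : nat) : cis (2 * pi * k%:R) = 1.
  elim: k => [|k IH]; first by rewrite mulr0 cis0.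
  rewrite -[k.+1%:R]natr1 mulrDr cisD IH mul1r mulr1 /cis.
  by rewrite mulr_natl cos2pi sin2pi.
case: (intP n) => [|k|k]; first by rewrite mulr0 cis0.
  exact: nat_case.
rewrite mulrNz mulrN -[LHS]mul1r -{1}(nat_case k.+1) -cisD.
by rewrite subrr cis0.
Qed.

Lemma cis_omega (T : R) (n : int) s : 0 < T ->
  cis (omega T n * (s + T)) = cis (omega T n * s).
Proof.
move=> T0; rewrite mulrDr cisD [X in _ * cis X](_ : _ = 2 * pi * n%:~R).
  by rewrite cis2pi mulr1.
by rewrite /omega divfK// gt_eqF.
Qed.

End UnitCircle.

(** * Uniform limits of integrands *)

Section UniformContinuity.
Variables (R : realType) (H : completeNormedModType R[i]) (t : R).
Hypothesis t0 : 0 <= t.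
Implicit Types (phi psi : R -> H).

Lemma unif_cont_lim phi :
  (forall e : R, 0 < e -> exists2 psi, unif_cont t psi &
    forall x, 0 <= x -> x <= t -> rnorm (phi x - psi x) <= e) ->
  unif_cont t phi.
Proof.
move=> phiL e e0; have e3 : 0 < e / 3%:R by rewrite divr_gt0.
have [psi psiC phipsi] := phiL _ e3; have [d d0 dP] := psiC _ e3.
exists d => // x y x0 xy yt yxd.
have := dP _ _ x0 xy yt yxd.
have := phipsi x x0 (le_trans xy yt).
have := phipsi y (le_trans x0 xy) yt.
have := rnorm_dist_tri (psi y) (phi y) (phi x).
have := rnorm_dist_tri (psi x) (psi y) (phi x).
rewrite [rnorm (psi x - phi x)]rnorm_distC; lra.
Qed.

Lemma unif_cont_lipschitz phi (K : R) :
  (forall x y, 0 <= x -> x <= y -> y <= t ->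
    rnorm (phi y - phi x) <= K * (y - x)) ->
  unif_cont t phi.
Proof.
move=> phiK e e0; have K0 : 0 < `|K| + 1 by rewrite ltr_wpDl.
exists (e / (`|K| + 1)) => [|x y x0 xy yt]; first by rewrite divr_gt0.
rewrite ler_pdivlMr// => /(le_trans _); apply.
apply: le_trans (phiK _ _ x0 xy yt) _; rewrite mulrC ler_wpM2l ?subr_ge0//.
by rewrite (le_trans (ler_norm _))// lerDl.
Qed.

Lemma unif_cont_scale (psi : R -> R) phi (K L M : R) :
  (forall x, 0 <= x -> x <= t -> `|psi x| <= K) ->
  (forall x y, 0 <= x -> x <= y -> y <= t -> `|psi y - psi x| <= L * (y - x)) ->
  (forall x, 0 <= x -> x <= t -> rnorm (phi x) <= M) ->
  unif_cont t phi -> unif_cont t (fun x => (psi x)%:C *: phi x).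
Proof.
move=> psiK psiL phiM phiC e e0.
have K0 : 0 <= K by apply: le_trans (normr_ge0 _) (psiK 0 _ _).
have M0 : 0 <= M by apply: le_trans (rnorm_ge0 _) (phiM 0 _ _).
have L0 : 0 < `|L| + 1 by rewrite ltr_wpDl.
have [|d d0 dP] := phiC (e / (2 * (K + 1))).
  by rewrite divr_gt0// mulr_gt0// ltr_wpDl.
exists (Num.min d (e / (2 * (M + 1) * (`|L| + 1)))).
  by rewrite lt_min d0 divr_gt0// !mulr_gt0// ltr_wpDl.
move=> x y x0 xy yt; rewrite le_min => /andP[yd yL].
have -> : (psi y)%:C *: phi y - (psi x)%:C *: phi x =
    (psi y)%:C *: (phi y - phi x) + (psi y - psi x)%:C *: phi x.
  by rewrite scalerBr rmorphB scalerBl /= addrA subrK.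
apply: le_trans (rnormD _ _) _; rewrite !rnormZr [leRHS]splitr lerD//.
  apply: (@le_trans _ _ (K * (e / (2 * (K + 1))))).
    by rewrite ler_pM ?rnorm_ge0 ?psiK ?dP// (le_trans x0).
  rewrite mulrA ler_pdivrMr ?mulr_gt0 ?ltr_wpDl//.
  have -> : e / 2 * (2 * (K + 1)) = e * (K + 1) by field.
  by rewrite mulrC ler_wpM2l ?lerDl// ltW.
apply: (@le_trans _ _ (((`|L| + 1) * (y - x)) * M)).
  apply: ler_pM; rewrite ?rnorm_ge0 ?phiM ?(le_trans xy)//.
  apply: le_trans (psiL _ _ x0 xy yt) _; rewrite ler_wpM2r ?subr_ge0//.
  by rewrite (le_trans (ler_norm _))// lerDl.
move: yL; rewrite ler_pdivlMr ?mulr_gt0 ?ltr_wpDl// => yL.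
have yx0 : 0 <= y - x by rewrite subr_ge0.
have : 0 <= (`|L| + 1) * (y - x) by rewrite mulr_ge0// ltW.
set l := `|L| + 1 in L0 yL *; set h := y - x in yL yx0 *.
move=> lh; nra.
Qed.

Lemma primitive_quadratic (G g : R -> H) (K : R) :
  (forall x y, 0 <= x -> x <= y -> y <= t ->
    rnorm (G y - G x - (y - x)%:C *: g y) <= K * (y - x) ^+ 2) ->
  primitive t G g.
Proof.
move=> GK e e0; have K0 : 0 < `|K| + 1 by rewrite ltr_wpDl.
exists (e / (`|K| + 1)) => [|x y x0 xy yt]; first by rewrite divr_gt0.
rewrite ler_pdivlMr// => yxe; apply: le_trans (GK _ _ x0 xy yt) _.
rewrite expr2 mulrA ler_wpM2r ?subr_ge0//; apply: le_trans yxe.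
by rewrite mulrC ler_wpM2l ?subr_ge0// (le_trans (ler_norm _))// lerDl.
Qed.

End UniformContinuity.

Section IntegralLimit.
Variables (R : realType) (H : completeNormedModType R[i]).
Variables (dot : {dot H for Num.conj}).
Hypothesis dotE : forall x : H, `|x| ^+ 2 = dot x x.
Variable t : R.
Hypothesis t0 : 0 <= t.

Lemma integrates_lim (phi : R -> H) (v : H) :
  (forall e : R, 0 < e -> exists psi w, [/\ integrates t psi w,
    forall x, 0 <= x -> x <= t -> rnorm (phi x - psi x) <= e &
    rnorm (w - v) <= e]) ->
  integrates t phi v.
Proof.
move=> phiL; have phiC : unif_cont t phi.
  by apply: unif_cont_lim => e /phiL[psi [w [[psiC _] phipsi _]]]; exists psi.
have [u phiu] := integrates_exists dotE t0 phiC.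
suff -> : v = u by [].
apply/eqP; rewrite -subr_eq0; apply/eqP/rnorm_eq0/eqP.
rewrite eq_le rnorm_ge0 andbT; apply/ler_addgt0Pr => e e0; rewrite add0r.
have d0 : 0 < e / (t + 1) by rewrite divr_gt0// ltr_wpDl.
have [psi [w [psiw phipsi wv]]] := phiL _ d0.
have uw := integrates_norm t0 (integratesB phiu psiw) phipsi.
apply: le_trans (rnorm_dist_tri w _ _) _.
rewrite rnorm_distC [rnorm (w - u)]rnorm_distC.
have eE : e = t * (e / (t + 1)) + e / (t + 1).
  by field; rewrite gt_eqF// ltr_wpDl.
lra.
Qed.

Lemma integrates0 : integrates t (fun=> 0 : H) 0.
Proof.
have C0 : unif_cont t (fun=> 0 : H).
  by apply: (@unif_cont_lipschitz _ _ _ _ 0) => x y *; rewrite subrr rnorm0 mul0r.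
have [v /[dup] v0 /(integratesZ 0)] := integrates_exists dotE t0 C0.
by under eq_fun do rewrite scaler0; rewrite scale0r.
Qed.

Lemma integrates_sum (N : nat) (phi : nat -> R -> H) (v : nat -> H) :
  (forall k, integrates t (phi k) (v k)) ->
  integrates t (fun x => \sum_(k < N) phi k x) (\sum_(k < N) v k).
Proof.
move=> phiv; elim: N => [|N IH].
  by under eq_fun do rewrite big_ord0; rewrite big_ord0; apply: integrates0.
under eq_fun do rewrite big_ord_recr /=; rewrite big_ord_recr /=.
exact: integratesD.
Qed.

End IntegralLimit.

(** * Geometrically convergent sequences and periodic test functions *)

Lemma halving_le (R : realType) (b : nat -> R) :
  (forall n, 2 * b n.+1 <= b n) -> forall n, 2 ^+ n * b n <= b 0.
Proof.
move=> bS; elim=> [|n IH]; first by rewrite expr0 mul1r.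
by apply: le_trans IH; rewrite exprSr -mulrA ler_wpM2l// exprn_ge0.
Qed.

Lemma halving_small (R : realType) (b : nat -> R) :
  (forall n, 2 * b n.+1 <= b n) ->
  forall e : R, 0 < e -> exists N, b N < e.
Proof.
move=> bS e e0; exists (Num.truncn (`|b 0| / e)); set N := Num.truncn _.
have : `|b 0| < e * 2 ^+ N.
  rewrite mulrC -ltr_pdivrMr//; apply: lt_le_trans (truncnS_gt _) _.
  by rewrite -/N -natrX ler_nat ltn_expl.
rewrite mulrC => b0; rewrite -(ltr_pM2l (exprn_gt0 N (ltr0n R 2))).
by apply: le_lt_trans b0; apply: le_trans (halving_le bS N) (ler_norm _).
Qed.

(** The weights from b N on sum to at most 2 b N.  The bound is relative to
    b N because the gliding hump compares the tail of its series with the number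
    of periods already chosen. *)
Lemma halving_cvg (R : realType) (H : completeNormedModType R[i])
    (u : nat -> H) (b : nat -> R) :
  (forall n, rnorm (u n.+1 - u n) <= b n) -> (forall n, 2 * b n.+1 <= b n) ->
  forall N, rnorm (lim (u n @[n --> \oo]) - u N) <= 2 * b N.
Proof.
move=> ub bS; have b0 n : 0 <= b n by apply: le_trans (rnorm_ge0 _) (ub n).
have tail N k : rnorm (u (N + k)%N - u N) <= 2 * b N - 2 * b (N + k)%N.
  elim: k => [|k IH]; first by rewrite addn0 !subrr rnorm0.
  rewrite addnS; apply: le_trans (rnorm_dist_tri (u (N + k)%N) _ _) _.
  apply: le_trans (lerD (ub _) IH) _; have := bS (N + k)%N; lra.
have tail' N k : rnorm (u (N + k)%N - u N) <= 2 * b N.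
  by apply: le_trans (tail N k) _; rewrite gerBl mulr_ge0.
have [l ul] : exists l : H, u n @[n --> \oo] --> l.
  apply: rnorm_cauchy_cvg => e e0.
  have [N bN] := halving_small bS (divr_gt0 e0 (ltr0n R 4)).
  exists N => n k Nn Nk.
  have : rnorm (u n - u N) <= 2 * b N by rewrite -(subnKC Nn) tail'.
  have : rnorm (u k - u N) <= 2 * b N by rewrite -(subnKC Nk) tail'.
  have := rnorm_dist_tri (u N) (u n) (u k).
  rewrite [rnorm (u N - _)]rnorm_distC; lra.
move=> N; rewrite (cvg_lim _ ul)//.
apply/ler_addgt0Pr => e e0; have [K KP] := (cvgn_rnormP _ _).1 ul _ e0.
have := KP (N + K)%N (leq_addl _ _); rewrite rnorm_distC => /ltW.
have := rnorm_dist_tri (u (N + K)%N) l (u N).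
have := tail' N K; lra.
Qed.

Section SmoothTest.
Variables (R : realType) (T : R) (phi : R -> R).
Hypotheses (T0 : 0 <= T) (phi_smooth : smooth_per T phi).

Lemma smooth_is_derive (j : nat) (z : R) :
  is_derive z 1 (derive1n j phi) (derive1n j.+1 phi z).
Proof.
by have := phi_smooth.2 j z; rewrite derive1nS derive1E => h; apply: DeriveDef.
Qed.

Lemma smooth_per_derive j x : derive1n j phi (x + T) = derive1n j phi x.
Proof.
elim: j x => [|j IH] x; first by case: phi_smooth => + _; apply.
rewrite !derive1nS /derive1; set f := derive1n j phi.
suff -> : (fun h => h^-1 *: (f (h + (x + T)) - f (x + T))) =
  (fun h => h^-1 *: (f (h + x) - f x)) by [].
by apply/funext => h; rewrite addrA /f !IH.
Qed.

Lemma smooth_bounded j : exists K, forall x, 0 <= x -> x <= T ->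
  `|derive1n j phi x| <= K.
Proof.
have cont : {within `[0, T], continuous (fun x => `|derive1n j phi x|)}.
  apply: continuous_subspaceT => x.
  have dx : {for x, continuous (derive1n j phi)}.
    apply: differentiable_continuous; apply/derivable1_diffP.
    exact: phi_smooth.2.
  by apply: (continuous_comp dx); apply: norm_continuous.
have [c _ cmax] := EVT_max T0 cont.
by exists `|derive1n j phi c| => x x0 xT; apply: cmax; rewrite in_itv /= x0.
Qed.

Lemma smooth_lipschitz j K :
  (forall x, 0 <= x -> x <= T -> `|derive1n j.+1 phi x| <= K) ->
  forall x y, 0 <= x -> x <= y -> y <= T ->
    `|derive1n j phi y - derive1n j phi x| <= K * (y - x).
Proof.
move=> dK x y x0 xy yT; apply: (derive_le_dist xy (smooth_is_derive j)) => z xz zy.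
by apply: dK; [exact: le_trans xz|exact: le_trans yT].
Qed.

Lemma smooth_taylor j K :
  (forall x, 0 <= x -> x <= T -> `|derive1n j.+2 phi x| <= K) ->
  forall x y, 0 <= x -> x <= y -> y <= T ->
    `|derive1n j phi y - derive1n j phi x - (y - x) * derive1n j.+1 phi y|
      <= K * (y - x) ^+ 2.
Proof.
move=> dK x y x0 xy yT; set f := derive1n j phi; set df := derive1n j.+1 phi.
(* mean value inequality for f minus its linear part at y *)
have -> : f y - f x - (y - x) * df y = (f y - df y * y) - (f x - df y * x) by ring.
rewrite expr2 mulrA.
apply: (derive_le_dist (f := fun z => f z - df y * z)
  (df := fun z => df z - df y) xy).
  move=> z; apply: is_deriveB; first exact: smooth_is_derive.
  by rewrite -[X in is_derive _ _ _ X]mulr1; apply: is_deriveZ.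
move=> z xz zy; rewrite distrC.
apply: le_trans (smooth_lipschitz dK (le_trans x0 xz) zy yT) _.
by rewrite ler_wpM2l ?lerB// (le_trans _ (dK 0 _ _)).
Qed.

End SmoothTest.

(** * A single mode against a test function *)

Section ImaginaryUnit.
Variable R : realType.
Local Notation normc := Normc.normc.

Lemma imC_Zr (r a : R) : 0 +i* (r * a) = r%:C * (0 +i* a).
Proof. by apply/eqP; rewrite eq_complex /= !mul0r mulr0 subr0 addr0 !eqxx. Qed.

Lemma normc_im (a : R) : normc (0 +i* a) = `|a|.
Proof. by rewrite /= expr0n add0r sqrtr_sqr. Qed.

Lemma normc_real (a : R) : normc a%:C = `|a|.
Proof. by rewrite /= expr0n addr0 sqrtr_sqr. Qed.

Lemma normcD_le (a b : R[i]) : normc (a + b) <= normc a + normc b.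
Proof. exact: le_normcD. Qed.

End ImaginaryUnit.

Section Mode.
Variables (R : realType) (H : completeNormedModType R[i]).
Variables (T : R) (T0 : 0 <= T) (phi : R -> R).
Hypothesis phi_smooth : smooth_per T phi.
Local Notation normc := Normc.normc.
Local Notation "phi ^[ j ]" := (derive1n j phi) (at level 2, format "phi ^[ j ]").

Definition mode (theta : R) (z : H) (s : R) : H := cis (theta * s) *: z.

Lemma rnorm_mode theta z s : rnorm (mode theta z s) = rnorm z.
Proof. by rewrite /mode rnormZ normc_cis mul1r. Qed.

Lemma mode_lipschitz theta z x y : x <= y ->
  rnorm (mode theta z y - mode theta z x) <= `|theta| * rnorm z *+ 2 * (y - x).
Proof.
move=> xy; rewrite /mode (_ : theta * y = theta * x + theta * (y - x));
  last by ring.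
rewrite cisD -scalerBl rnormZ -[X in _ - X]mulr1 -mulrBr.
rewrite Normc.normcM normc_cis mul1r.
apply: le_trans (ler_wpM2r (rnorm_ge0 _) (normc_cisB1 _)) _.
rewrite normrM (ger0_norm (_ : 0 <= y - x)) ?subr_ge0//.
by rewrite le_eqVlt; apply/orP; left; apply/eqP; ring.
Qed.

Lemma unif_cont_mode t theta z : unif_cont t (mode theta z).
Proof. by apply: unif_cont_lipschitz => x y _ xy _; apply: mode_lipschitz xy. Qed.

Lemma unif_cont_test j (f : R -> H) M : unif_cont T f ->
  (forall x, 0 <= x -> x <= T -> rnorm (f x) <= M) ->
  unif_cont T (fun x => (phi^[j] x)%:C *: f x).
Proof.
move=> fC fM; have [K KP] := smooth_bounded T0 phi_smooth j.
have [L LP] := smooth_bounded T0 phi_smooth j.+1.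
apply: (unif_cont_scale (L := L) T0 KP _ fM fC).
exact: (smooth_lipschitz phi_smooth LP).
Qed.

(** The product rule.  With h = y - x and tau the second order remainder of
    cis (- theta h), the error over [x, y] is the multiple of cis (theta y) z by

      (phi y - phi x - h phi' y) - phi x tau + i theta h (phi x - phi y),

    where phi stands for its j-th derivative; all three terms are O(h^2). *)
Lemma mode_primitive j theta z :
  primitive T (fun x => (phi^[j] x)%:C *: mode theta z x)
    (fun x => (phi^[j.+1] x)%:C *: mode theta z x +
              (phi^[j] x)%:C *: mode theta ((0 +i* theta) *: z) x).
Proof.
have [K0 K0P] := smooth_bounded T0 phi_smooth j.
have [K1 K1P] := smooth_bounded T0 phi_smooth j.+1.
have [K2 K2P] := smooth_bounded T0 phi_smooth j.+2.
apply: (primitive_quadratic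
  (K := (K2 + K0 * (theta ^+ 2 *+ 2) + `|theta| * K1) * rnorm z)).
move=> x y x0 xy yT; rewrite /mode.
set h := y - x; have h0 : 0 <= h by rewrite subr_ge0.
set fy := phi^[j] y; set fx := phi^[j] x; set dy := phi^[j.+1] y.
have fxK : `|fx| <= K0 by apply: K0P => //; apply: le_trans yT.
have K0_ge0 : 0 <= K0 := le_trans (normr_ge0 _) fxK.
have fE : `|fy - fx - h * dy| <= K2 * h ^+ 2.
  exact: (smooth_taylor T0 phi_smooth K2P x0 xy yT).
have fL : `|fx - fy| <= K1 * h.
  by rewrite distrC; exact: (smooth_lipschitz phi_smooth K1P x0 xy yT).
set a := cis (theta * y).
have -> : cis (theta * x) = a * cis (- (theta * h)).
  by rewrite /a -cisD; congr (cis _); rewrite /h; ring.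
set tau := cis (- (theta * h)) - 1 - 0 +i* (- (theta * h)).
have tauE : cis (- (theta * h)) = tau + 1 - h%:C * (0 +i* theta).
  have imE : 0 +i* (- (theta * h)) = - (h%:C * (0 +i* theta)).
    rewrite -imC_Zr [h * _]mulrC.
    by apply/eqP; rewrite eq_complex /= oppr0 !eqxx.
  by rewrite /tau imE; ring.
have tauN : normc tau <= theta ^+ 2 *+ 2 * h ^+ 2.
  apply: le_trans (normc_cis_taylor _) _.
  by rewrite sqrrN exprMn mulrnAl.
clearbody h tau.
have -> : fy%:C *: (a *: z) - fx%:C *: ((a * cis (- (theta * h))) *: z) -
    h%:C *: (dy%:C *: (a *: z) + fy%:C *: (a *: ((0 +i* theta) *: z))) =
  (a * ((fy - fx - h * dy)%:C - fx%:C * tau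
        + h%:C * (0 +i* theta) * (fx - fy)%:C)) *: z.
  rewrite !scalerDr !scalerA -!scalerDl -!scalerBl; congr (_ *: _).
  rewrite tauE; move: (0 +i* theta) => I.
  by rewrite !rmorphB rmorphM /=; ring.
rewrite rnormZ Normc.normcM normc_cis mul1r [leRHS]mulrAC ler_wpM2r ?rnorm_ge0//.
apply: le_trans (normcD_le _ _) _; rewrite 2!mulrDl; apply: lerD.
  apply: le_trans (normcD_le _ _) _; apply: lerD; first by rewrite normc_real.
  rewrite normcN Normc.normcM normc_real -mulrA.
  by apply: ler_pM => //; case: (tau) => u v; apply: sqrtr_ge0.
rewrite !Normc.normcM !normc_real normc_im ger0_norm// expr2.
apply: le_trans (ler_wpM2l (mulr_ge0 h0 (normr_ge0 theta)) fL) _.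
by rewrite le_eqVlt; apply/orP; left; apply/eqP; ring.
Qed.

End Mode.

(** * Trigonometric series in Sobolev spaces *)

Section TrigonometricSeries.
Variables (R : realType) (H : completeNormedModType R[i]).
Variables (dot : {dot H for Num.conj}).
Hypothesis dotE : forall x : H, `|x| ^+ 2 = dot x x.
Variables (T : R) (T_gt0 : 0 < T) (d : nat) (theta : nat -> R) (z : nat -> H).
Hypothesis theta_per : forall k s, cis (theta k * (s + T)) = cis (theta k * s).
Variable b : nat -> R.
Hypothesis b_halving : forall k, 2 * b k.+1 <= b k.
Hypothesis z_small : forall i k, (i <= d)%N ->
  `|theta k| ^+ i * rnorm (z k) <= b k.

Let T0 : 0 <= T := ltW T_gt0.

(** The index [i] counts termwise derivatives. *)
Definition coefficient i k : H := (0 +i* theta k) ^+ i *: z k.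

Definition partial_sum i N (s : R) : H :=
  \sum_(k < N) mode (theta k) (coefficient i k) s.

Definition trig_series i (s : R) : H := lim (partial_sum i N s @[N --> \oo]).

Lemma coefficientS i k : coefficient i.+1 k = (0 +i* theta k) *: coefficient i k.
Proof. by rewrite /coefficient exprS scalerA. Qed.

Lemma coefficient_small i k : (i <= d)%N ->
  rnorm (coefficient i k) <= b k.
Proof.
move=> id; apply: le_trans (z_small k id); rewrite rnormZ.
suff -> : Normc.normc ((0 +i* theta k) ^+ i) = `|theta k| ^+ i by [].
elim: (i) => [|n IH]; first by rewrite !expr0 normc_real normr1.
by rewrite !exprS Normc.normcM IH normc_im.
Qed.

Lemma trig_series_close i N s : (i <= d)%N ->
  rnorm (trig_series i s - partial_sum i N s) <= 2 * b N.
Proof.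
move=> id; apply: halving_cvg b_halving _ => n.
rewrite /partial_sum big_ord_recr /= addrAC subrr add0r rnorm_mode.
exact: coefficient_small.
Qed.

Lemma trig_series_bounded i s : (i <= d)%N -> rnorm (trig_series i s) <= 2 * b 0.
Proof.
move=> id; have := trig_series_close 0 s id.
by rewrite /partial_sum big_ord0 subr0.
Qed.

Lemma trig_series_per i s : trig_series i (s + T) = trig_series i s.
Proof.
rewrite /trig_series; suff -> : (fun N => partial_sum i N (s + T)) =
  (fun N => partial_sum i N s) by [].
by apply/funext => N; apply: eq_bigr => k _; rewrite /mode theta_per.
Qed.

Lemma trig_series_lim i (e : R) : (i <= d)%N -> 0 < e ->
  exists N, forall s, rnorm (trig_series i s - partial_sum i N s) <= e.
Proof.
move=> id e0; have [N Ne] := halving_small b_halving (divr_gt0 e0 (ltr0n R 2)).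
exists N => s; apply: le_trans (trig_series_close N s id) _; lra.
Qed.

Lemma unif_cont_partial_sum t i N : 0 <= t -> unif_cont t (partial_sum i N).
Proof.
move=> t0; elim: N => [|N IH].
  apply: (@unif_cont_lipschitz _ _ _ _ 0) => x y _ _ _.
  by rewrite /partial_sum !big_ord0 subrr rnorm0 mul0r.
rewrite (_ : partial_sum i N.+1 = fun x =>
    partial_sum i N x + mode (theta N) (coefficient i N) x).
  by apply: unif_contD => //; apply: unif_cont_mode.
by apply/funext => x; rewrite /partial_sum big_ord_recr.
Qed.

Lemma unif_cont_trig_series t i : 0 <= t -> (i <= d)%N ->
  unif_cont t (trig_series i).
Proof.
move=> t0 id; apply: unif_cont_lim => e /(trig_series_lim id)[N Ne].
by exists (partial_sum i N); first exact: unif_cont_partial_sum.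
Qed.

Lemma L2_per_trig_series i : (i <= d)%N -> L2_per T (trig_series i).
Proof.
move=> id; have fC := unif_cont_trig_series T0 id; split.
- exact: trig_series_per.
- by exists (step T (trig_series i)); apply: strongly_measurable_step.
apply: le_lt_trans (ltry ((2 * b 0) ^+ 2 * T)); apply: integral_itv0_le.
- by [].
- by apply: measurable_funX; apply: measurable_rnorm.
- exact: sqr_ge0.
move=> x _ _; rewrite exprn_ge0 ?rnorm_ge0//=.
have b0 : 0 <= 2 * b 0 := le_trans (rnorm_ge0 _) (trig_series_bounded x id).
by rewrite lerXn2r ?nnegrE ?rnorm_ge0 ?trig_series_bounded.
Qed.

Section TestFunction.
Variables (phi : R -> R) (phi_smooth : smooth_per T phi).
Local Notation "phi ^[ j ]" := (derive1n j phi) (at level 2, format "phi ^[ j ]").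

Lemma integrates_mode j i k :
  integrates T (fun x => (phi^[j.+1] x)%:C *: mode (theta k) (coefficient i k) x +
      (phi^[j] x)%:C *: mode (theta k) (coefficient i.+1 k) x) 0.
Proof.
have := primitive_integrates T0 _
  (mode_primitive T0 phi_smooth j (theta k) (coefficient i k)).
rewrite -coefficientS.
have -> : (phi^[j] T)%:C *: mode (theta k) (coefficient i k) T -
    (phi^[j] 0)%:C *: mode (theta k) (coefficient i k) 0 = 0.
  rewrite -[T in phi^[j] T]add0r (smooth_per_derive phi_smooth).
  by rewrite -{1}[T]add0r /mode theta_per subrr.
have test_mode a (w : H) :
    unif_cont T (fun x => (phi^[a] x)%:C *: mode (theta k) w x).
  apply: (@unif_cont_test R H T T0 phi phi_smooth a _ (rnorm w)).
    exact: unif_cont_mode.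
  by move=> x _ _; rewrite rnorm_mode.
by apply; apply: unif_contD; apply: test_mode.
Qed.

(** For partial sums the integrand is the derivative of a T-periodic function;
    the order [i < d] leaves room for one more derivative in the limit. *)
Lemma integrates_trig_series j i : (i < d)%N ->
  integrates T (fun x => (phi^[j.+1] x)%:C *: trig_series i x +
      (phi^[j] x)%:C *: trig_series i.+1 x) 0.
Proof.
move=> id; have [K KP] := smooth_bounded T0 phi_smooth j.+1.
have [K' KP'] := smooth_bounded T0 phi_smooth j.
have K0 : 0 <= K by apply: le_trans (normr_ge0 _) (KP 0 _ _).
have K'0 : 0 <= K' by apply: le_trans (normr_ge0 _) (KP' 0 _ _).
apply: (integrates_lim dotE) => // e e0.
have e'0 : 0 < e / (K + K' + 1) by rewrite divr_gt0// ltr_wpDl// addr_ge0.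
have [N Ne] := halving_small b_halving (divr_gt0 e'0 (ltr0n R 2)).
have {}Ne : 2 * b N <= e / (K + K' + 1) by lra.
exists (fun x => (phi^[j.+1] x)%:C *: partial_sum i N x +
      (phi^[j] x)%:C *: partial_sum i.+1 N x), 0; split.
- have := integrates_sum dotE T0 N (integrates_mode j i).
  rewrite big1// => h; rewrite [X in integrates _ X](_ : _ = fun x =>
    \sum_(k < N) ((phi^[j.+1] x)%:C *: mode (theta k) (coefficient i k) x +
      (phi^[j] x)%:C *: mode (theta k) (coefficient i.+1 k) x))//.
  by apply/funext => x; rewrite /partial_sum !scaler_sumr big_split.
- move=> x x0 xT; rewrite opprD addrACA -!scalerBr.
  apply: le_trans (rnormD _ _) _; rewrite !rnormZr.
  apply: (@le_trans _ _ (K * (e / (K + K' + 1)) + K' * (e / (K + K' + 1)))).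
    apply: lerD; apply: ler_pM; rewrite ?rnorm_ge0 ?normr_ge0 ?KP ?KP'//.
      by apply: le_trans (trig_series_close N x (ltnW id)) Ne.
    by apply: le_trans (trig_series_close N x id) Ne.
  rewrite -mulrDl mulrA ler_pdivrMr; last by rewrite ltr_wpDl// addr_ge0.
  by rewrite mulrC ler_wpM2l ?lerDl// ltW.
- by rewrite subrr rnorm0 ltW.
Qed.

Lemma unif_cont_test_trig_series j i : (i <= d)%N ->
  unif_cont T (fun x => (phi^[j] x)%:C *: trig_series i x).
Proof.
move=> id; apply: (unif_cont_test T0 phi_smooth) => [|x _ _].
  exact: unif_cont_trig_series.
exact: trig_series_bounded.
Qed.

Lemma integrates_by_parts j i v : (i + j <= d)%N ->
  integrates T (fun x => (phi^[j] x)%:C *: trig_series i x) v ->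
  integrates T (fun x => (phi x)%:C *: trig_series (i + j) x) ((-1) ^+ j *: v).
Proof.
elim: j i v => [|j IH] i v; first by rewrite addn0 expr0 scale1r.
rewrite addnS => ijd iv.
have id : (i < d)%N by apply: leq_trans ijd; rewrite ltnS leq_addr.
have := integratesB (integrates_trig_series j id) iv.
rewrite [X in integrates _ X](_ : _ = fun x =>
    (phi^[j] x)%:C *: trig_series i.+1 x).
  by move=> /IH; rewrite addSn sub0r exprSr -scalerA scaleN1r; apply.
by apply/funext => x; rewrite addrC addKr.
Qed.

End TestFunction.

Lemma sobolev_trig_series : sobolev_per T d (trig_series 0).
Proof.
split=> [|j jd]; first exact: L2_per_trig_series.
exists (trig_series j); first exact: L2_per_trig_series.
move=> phi phi_smooth.
have [v vP] := integrates_exists dotE T0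
  (unif_cont_test_trig_series phi_smooth j (leq0n d)).
(* the two signs of (-1)^j in the definition of the weak derivative cancel *)
exists ((-1) ^+ j *: v); split.
  rewrite scalerA -exprD addnn -signr_odd odd_double expr0 scale1r.
  exact: (integrates_bochner dotE).
have := integrates_by_parts phi_smooth (i := 0) jd vP.
by rewrite add0n; exact: (integrates_bochner dotE).
Qed.

End TrigonometricSeries.

(** * A semigroup convolved with a mode *)

Lemma subr_rearrange (V : zmodType) (p q r x u v : V) :
  p - q - r = p - x - u - (q - x - v) - (r - (u - v)).
Proof.
have -> : p - x - u - (q - x - v) = p - q - (u - v).
  by rewrite [- (q - x - v)]opprD opprK addrACA opprB subrKA opprB [- u + v]addrC.
by rewrite [- (r - _)]opprB subrKA.
Qed.

Lemma near_at_right0 (R : realType) (P : R -> Prop) :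
  (\forall h \near 0^'+, P h) -> exists2 d : R, 0 < d &
    forall h, 0 < h -> h <= d -> P h.
Proof.
move=> [d /= d0 dP]; exists (d / 2); first by rewrite divr_gt0.
move=> h h0 hd; apply: dP => //=; rewrite sub0r normrN gtr0_norm//.
by apply: le_lt_trans hd _; rewrite ltr_pdivrMr// ltr_pMr// ltr1n.
Qed.

Lemma opnorm_le (R : realType) (H : normedModType R[i]) (B : {linear H -> H})
    (M : R) : (opnorm B <= M%:E)%E -> forall x, rnorm (B x) <= M * rnorm x.
Proof.
move=> BM x; have [/rnorm_eq0 ->|x0] := eqVneq (rnorm x) 0.
  by rewrite linear0 rnorm0 mulr0.
have {}x0 : 0 < rnorm x by rewrite lt_def x0 rnorm_ge0.
have BxM y : rnorm y <= 1 -> rnorm (B y) <= M.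
  move=> y1; rewrite -lee_fin; apply: le_trans BM.
  by apply: ereal_sup_ubound; exists y.
have := BxM ((rnorm x)^-1%:C *: x); rewrite linearZ /= !rnormZr.
rewrite gtr0_norm ?invr_gt0// mulVf ?gt_eqF// lexx => /(_ isT).
by rewrite mulrC ler_pdivrMr.
Qed.

Section Semigroup.
Variables (R : realType) (H : completeNormedModType R[i]).
Variables (S : R -> {linear H -> H}) (domA : set H) (A : H -> H).
Hypotheses (S_C0 : C0_semigroup S) (S_gen : is_generator S domA A).
Variable M : R.
Hypothesis M_ge0 : 0 <= M.
Hypothesis S_bound : forall t x, 0 <= t -> rnorm (S t x) <= M * rnorm x.

Let S0 x : S 0 x = x. Proof. by case: S_C0. Qed.

Let SD s t x : 0 <= s -> 0 <= t -> S (s + t) x = S s (S t x).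
Proof. by case: S_C0 => _ _ + _; apply. Qed.

Lemma semigroup_small x e : 0 < e -> exists2 d : R, 0 < d &
  forall h, 0 <= h -> h <= d -> rnorm (S h x - x) <= e.
Proof.
move=> e0; case: S_C0 => _ _ _ /(_ x) /cvg_rnormP /(_ _ e0).
move=> /near_at_right0[d d0 dP]; exists d => // h; rewrite le_eqVlt.
move=> /predU1P[<- _|h0 hd]; first by rewrite S0 subrr rnorm0 ltW.
exact/ltW/dP.
Qed.

Lemma generator_taylor x e : domA x -> 0 < e -> exists2 d : R, 0 < d &
  forall h, 0 <= h -> h <= d -> rnorm (S h x - x - h%:C *: A x) <= e * h.
Proof.
move=> /(S_gen.2 x) /cvg_rnormP Ax e0.
have [d d0 dP] := near_at_right0 (Ax _ e0); exists d => // h; rewrite le_eqVlt.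
move=> /predU1P[<- _|h0 hd].
  by rewrite S0 subrr sub0r scale0r oppr0 rnorm0 mulr0.
have -> : S h x - x - h%:C *: A x = h%:C *: ((h^-1)%:C *: (S h x - x) - A x).
  by rewrite scalerBr scalerA -rmorphM mulfV ?gt_eqF// scale1r.
by rewrite rnormZr gtr0_norm// mulrC ler_wpM2r// ltW// dP.
Qed.

Lemma cis_small (theta : R) (x : H) e : 0 < e -> exists2 d : R, 0 < d &
  forall h, 0 <= h -> h <= d -> rnorm (cis (theta * h) *: x - x) <= e.
Proof.
move=> e0; pose K := `|theta| * rnorm x *+ 2.
have K0 : 0 <= K by rewrite mulrn_wge0// mulr_ge0// rnorm_ge0.
exists (e / (K + 1)) => [|h h0]; first by rewrite divr_gt0// ltr_wpDl.
rewrite ler_pdivlMr ?ltr_wpDl// => hK.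
have := mode_lipschitz theta x h0.
rewrite /mode mulr0 cis0 scale1r subr0 -/K => /le_trans; apply.
by apply: le_trans hK; rewrite mulrC ler_wpM2l// lerDl.
Qed.

Variable t : R.
Hypothesis t0 : 0 <= t.

Let subK x y : x <= y -> y <= t -> forall z, S (t - x) z = S (t - y) (S (y - x) z).
Proof.
move=> xy yt z; rewrite -SD ?subr_ge0//; congr (S _ _).
by rewrite addrA subrK.
Qed.

(** The semigroup law moves S(t - b) to the front of the increment over [a, b];
    what remains is e^(i theta h) y - S(h) y with h = b - a, small by strong
    continuity at 0. *)
Lemma unif_cont_conv_mode theta y :
  unif_cont t (fun s => S (t - s) (mode theta y s)).
Proof.
move=> e e0; have e' : 0 < e / (M + 1) / 2 by rewrite !divr_gt0// ltr_wpDl.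
have [d d0 dP] := semigroup_small y e'.
have [d' d'0 dP'] := cis_small theta y e'.
exists (Num.min d d'); first by rewrite lt_min d0.
move=> a b a0 ab bt; rewrite le_min => /andP[bd bd'].
rewrite (subK ab bt) -linearB; apply: le_trans (S_bound _ _) _; rewrite ?subr_ge0//.
rewrite /mode (_ : theta * b = theta * a + theta * (b - a)); last by ring.
rewrite cisD -scalerA [S _ (_ *: _)]linearZ /= -scalerBr rnormZ normc_cis mul1r.
have h0 : 0 <= b - a by rewrite subr_ge0.
have := rnorm_dist_tri y (cis (theta * (b - a)) *: y) (S (b - a) y).
have := dP _ h0 bd; have := dP' _ h0 bd'; rewrite [rnorm (y - _)]rnorm_distC.
set r := rnorm (_ - _) => r1; set r2 := rnorm (_ - _) => r3.
set r4 := rnorm (_ - _) => r5; have : r4 <= e / (M + 1) by lra.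
move=> /(ler_wpM2l M_ge0) /le_trans; apply.
rewrite mulrA ler_pdivrMr ?ltr_wpDl//.
by rewrite mulrC ler_wpM2l ?lerDl// ltW.
Qed.

Lemma unif_cont_conv (f : R -> H) :
  (forall e, 0 < e -> exists2 g, unif_cont t (fun s => S (t - s) (g s)) &
     forall s, rnorm (f s - g s) <= e) ->
  unif_cont t (fun s => S (t - s) (f s)).
Proof.
move=> fL; apply: unif_cont_lim => e e0.
have [|g gC fg] := fL (e / (M + 1)); first by rewrite divr_gt0// ltr_wpDl.
exists (fun s => S (t - s) (g s)) => // s s0 st; rewrite -linearB.
apply: le_trans (S_bound _ _) _; rewrite ?subr_ge0//.
apply: le_trans (ler_wpM2l M_ge0 (fg s)) _.
rewrite mulrA ler_pdivrMr ?ltr_wpDl//.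
by rewrite mulrC ler_wpM2l ?lerDl// ltW.
Qed.

(** Up to the isometry e^(i theta a) and the bounded operator S(t - b), the
    increment over [a, b] is e^(i theta h) x - S(h) x with h = b - a.  Its first
    order term is h (i theta x - A x), by Taylor expansion of the exponential and
    by definition of the generator. *)
Lemma primitive_conv_mode theta x : domA x ->
  primitive t (fun s => S (t - s) (mode theta x s))
    (fun s => S (t - s) (mode theta ((0 +i* theta) *: x - A x) s)).
Proof.
move=> xA e e0; set y := _ - A x.
have e' : 0 < e / (M + 1) / 3%:R by rewrite !divr_gt0// ltr_wpDl.
have [d d0 dP] := generator_taylor xA e'.
have [d' d'0 dP'] := cis_small theta y e'.
pose K := theta ^+ 2 *+ 2 * rnorm x.
have K0 : 0 <= K by rewrite mulr_ge0 ?rnorm_ge0// mulrn_wge0// sqr_ge0.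
exists (Num.min d (Num.min d' (e / (M + 1) / 3%:R / (K + 1)))).
  by rewrite !lt_min d0 d'0 divr_gt0// ltr_wpDl.
move=> a b a0 ab bt; rewrite !le_min => /and3P[bd bd' bK].
have h0 : 0 <= b - a by rewrite subr_ge0.
have {}dP := dP _ h0 bd; have {}dP' := dP' _ h0 bd'.
rewrite (subK ab bt) -linearZ -!linearB.
apply: le_trans (S_bound _ _) _; rewrite ?subr_ge0//.
rewrite /mode (_ : theta * b = theta * a + theta * (b - a)); last by ring.
rewrite cisD; set c := cis (theta * a); move: bK dP dP' h0.
set h := b - a => bK dP dP' h0; set w := cis (theta * h).
have -> : (c * w) *: x - S h (c *: x) - h%:C *: ((c * w) *: y) =
  c *: ((w - 1 - 0 +i* (theta * h)) *: x - (S h x - x - h%:C *: A x)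
        - h%:C *: (w *: y - y)).
  have -> : 0 +i* (theta * h) = h%:C * (0 +i* theta) by rewrite -imC_Zr mulrC.
  rewrite [S _ (_ *: _)]linearZ /= -!scalerA.
  rewrite [h%:C *: (c *: _)]scalerA [h%:C * c]mulrC -scalerA -!scalerBr.
  congr (c *: _); rewrite !scalerBl scale1r -scalerA [h%:C *: (_ - y)]scalerBr.
  by rewrite [h%:C *: y]scalerBr -subr_rearrange.
rewrite rnormZ normc_cis mul1r.
have wN : rnorm ((w - 1 - 0 +i* (theta * h)) *: x) <= K * h ^+ 2.
  rewrite rnormZ; apply: le_trans (ler_wpM2r (rnorm_ge0 _) (normc_cis_taylor _)) _.
  by rewrite exprMn le_eqVlt; apply/orP; left; apply/eqP; rewrite /K; ring.
have hK : K * h ^+ 2 <= e / (M + 1) / 3%:R * h.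
  rewrite expr2 mulrA ler_wpM2r//; move: bK; rewrite ler_pdivlMr ?ltr_wpDl//.
  by apply: le_trans; rewrite mulrC ler_wpM2l// lerDl.
have {}dP' : rnorm (h%:C *: (w *: y - y)) <= e / (M + 1) / 3%:R * h.
  by rewrite rnormZr ger0_norm// mulrC ler_wpM2r.
set X := _ *: x in wN *; set Y := _ - _ - _ in dP *; set Z := h%:C *: _ in dP' *.
have sum_le : rnorm (X - Y - Z) <= e / (M + 1) * h.
  have := rnormB (X - Y) Z; have := rnormB X Y; lra.
apply: le_trans (ler_wpM2l M_ge0 sum_le) _.
rewrite mulrA ler_wpM2r// mulrA ler_pdivrMr ?ltr_wpDl//.
by rewrite mulrC ler_wpM2l ?lerDl// ltW.
Qed.

Lemma integrates_conv_mode theta x : domA x ->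
  integrates t (fun s => S (t - s) (mode theta ((0 +i* theta) *: x - A x) s))
    (mode theta x t - S t x).
Proof.
move=> xA; have := primitive_integrates t0 (unif_cont_conv_mode _ _)
  (primitive_conv_mode theta xA).
by rewrite subrr S0 subr0 [mode _ _ 0]/mode mulr0 cis0 scale1r.
Qed.

End Semigroup.

(** * Resonance by a gliding hump *)

Section Resonance.
Variables (R : realType) (H : completeNormedModType R[i]).
Variables (dot : {dot H for Num.conj}).
Hypothesis dotE : forall x : H, `|x| ^+ 2 = dot x x.
Variables (S : R -> {linear H -> H}) (domA : set H) (A : H -> H).
Hypotheses (S_C0 : C0_semigroup S) (S_gen : is_generator S domA A).
Variable M : R.
Hypothesis M_ge0 : 0 <= M.
Hypothesis S_bound : forall t x, 0 <= t -> rnorm (S t x) <= M * rnorm x.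
Variable T : R.
Hypothesis T_gt0 : 0 < T.

Let S0 x : S 0 x = x. Proof. by case: S_C0. Qed.

Let pT0 (p : nat) : 0 <= p%:R * T. Proof. by rewrite mulr_ge0// ltW. Qed.

Definition conv (f : R -> H) (t s : R) : H := S (t - s) (f s).

(** At the multiples of T a periodic solution keeps the value u(0), and the free
    motion from u0 is bounded. *)
Lemma unbounded_static (f : R -> H) :
  (forall K : R, exists p v,
     integrates (p%:R * T) (conv f (p%:R * T)) v /\ K < rnorm v) ->
  statically_resonant S T f.
Proof.
move=> unb [u [[u0 um] u_per]].
have uT (p : nat) : u (p%:R * T) = u 0.
  elim: p => [|p IH]; first by rewrite mul0r.
  by rewrite -[p.+1%:R]natr1 mulrDl mul1r u_per.
have [p [v [pv]]] := unb (rnorm (u 0) + M * rnorm u0).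
rewrite -(integrates_bochner_uniq dotE (pT0 p) pv (um _ (pT0 p))) uT ltNge.
move=> /negP; apply; apply: le_trans (rnormB _ _) _.
by rewrite lerD2l S_bound.
Qed.

(** The mild solution starting from 0 consists of the forced part only. *)
Lemma unbounded_secular (f : R -> H) :
  (forall t, 0 <= t -> unif_cont t (conv f t)) ->
  (forall K : R, exists p v,
     integrates (p%:R * T) (conv f (p%:R * T)) v /\ K < rnorm v) ->
  secularly_resonant S f.
Proof.
move=> fC unb.
have uP t : exists v, 0 <= t -> integrates t (conv f t) v.
  have [t0|t0] := leP 0 t; last by exists 0.
  by have [v] := integrates_exists dotE t0 (fC t t0); exists v.
have [u {}uP] := choice uP.
exists u; split.
  exists 0 => t t0; rewrite linear0 subr0.
  exact/(integrates_bochner dotE t0)/uP.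
apply/eqyP => K _; have [p [v [pv Kv]]] := unb K.
apply: (@le_trans _ _ (rnorm v)%:E); first by rewrite lee_fin ltW.
apply: ereal_sup_ubound; exists (p%:R * T); first exact: pT0.
by rewrite (integrates_uniq dotE (pT0 p) pv (uP _ (pT0 p))).
Qed.

Variable d : nat.

(** The forcing mode e^(i theta s) (i theta x - A x) is bounded in the Sobolev
    norm of order [d] independently of [L].  After [p] periods the free motion
    from [x] has lost half of its norm, so the response x - S(pT) x of norm at
    least L / 2 is present. *)
Definition large_mode (L theta : R) (x : H) (p : nat) : Prop :=
  [/\ forall s, cis (theta * (s + T)) = cis (theta * s), domA x,
      forall i, (i <= d)%N ->
        `|theta| ^+ i * rnorm ((0 +i* theta) *: x - A x) <= 1,
      L <= rnorm x & rnorm (S (p%:R * T) x) <= rnorm x / 2].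

Section GlidingHump.
Variables (theta : R -> R) (x : R -> H) (p : R -> nat).
Hypothesis modes : forall L, large_mode L (theta L) (x L) (p L).

(** A state holds the weight b of the next mode and a bound B, uniform in time,
    on the response to the modes chosen so far.  The level L gives the next mode
    a response of at least b L / 2 = B + k + 1 after p periods.  Dividing b by
    2 (1 + p) makes the total weight of all later modes at most 1 / p, which
    offsets the length p T of the time interval. *)
Fixpoint hump_state (n : nat) : R * R :=
  if n is k.+1 then
    let: (b, B) := hump_state k in
    let L := 2 * (B + k.+1%:R) / b in
    (b / (2 * (1 + (p L)%:R)), B + b * ((1 + M) * rnorm (x L)))
  else (1, 0).

Definition weight n := (hump_state n).1.
Definition budget n := (hump_state n).2.
Definition level n : R := 2 * (budget n + n.+1%:R) / weight n.

Lemma weightS n : weight n.+1 = weight n / (2 * (1 + (p (level n))%:R)).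
Proof. by rewrite /level /weight /budget /=; case: (hump_state n). Qed.

Lemma budgetS n :
  budget n.+1 = budget n + weight n * ((1 + M) * rnorm (x (level n))).
Proof. by rewrite /level /weight /budget /=; case: (hump_state n). Qed.

Lemma weight_gt0 n : 0 < weight n.
Proof.
elim: n => [|n IH]; first exact: ltr01.
by rewrite weightS divr_gt0// mulr_gt0// ltr_pwDl.
Qed.

Lemma weight_halving n : 2 * weight n.+1 <= weight n.
Proof.
rewrite weightS mulrA ler_pdivrMr; last by rewrite mulr_gt0// ltr_pwDl.
rewrite mulrCA ler_wpM2l//.
by rewrite ler_peMr ?lerDl ?(ltW (weight_gt0 _)).
Qed.

Lemma weight_le1 n : weight n <= 1.
Proof.
elim: n => [|n IH] //; apply: le_trans IH.
by have := weight_halving n; have := weight_gt0 n.+1; lra.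
Qed.

Lemma weight_periods n : (p (level n))%:R * (2 * weight n.+1) <= 1.
Proof.
rewrite weightS; set q := _%:R; have q0 : 0 < 1 + q by rewrite ltr_pwDl.
have -> : q * (2 * (weight n / (2 * (1 + q)))) = weight n * (q / (1 + q)).
  by field; rewrite gt_eqF.
rewrite mulr_ile1 ?weight_le1 ?(ltW (weight_gt0 _))//.
  by rewrite divr_ge0// ltW.
by rewrite ler_pdivrMr// mul1r lerDr.
Qed.

Let th k := theta (level k).
Let xs k := x (level k).
Let zs k := (weight k)%:C *: ((0 +i* th k) *: xs k - A (xs k)).

Lemma hump_per k s : cis (th k * (s + T)) = cis (th k * s).
Proof. by case: (modes (level k)). Qed.

Lemma hump_small i k : (i <= d)%N -> `|th k| ^+ i * rnorm (zs k) <= weight k.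
Proof.
move=> id; rewrite rnormZr (gtr0_norm (weight_gt0 k)) mulrCA.
rewrite ler_piMr ?(ltW (weight_gt0 _))//.
by case: (modes (level k)) => _ _ + _ _; apply.
Qed.

Definition hump : R -> H := trig_series th zs 0.

Lemma hump_sobolev : sobolev_per T d hump.
Proof.
exact: (sobolev_trig_series dotE T_gt0 hump_per weight_halving hump_small).
Qed.

Lemma hump_close N s : rnorm (hump s - partial_sum th zs 0 N s) <= 2 * weight N.
Proof. exact: (trig_series_close weight_halving hump_small N s (leq0n d)). Qed.

Let psum_mode N t s : conv (partial_sum th zs 0 N) t s =
  \sum_(k < N) (weight k)%:C *:
     conv (mode (th k) ((0 +i* th k) *: xs k - A (xs k))) t s.
Proof.
rewrite /conv /partial_sum linear_sum; apply: eq_bigr => k _.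
rewrite /coefficient expr0 scale1r /mode /zs scalerA mulrC -scalerA.
by rewrite [LHS]linearZ.
Qed.

Lemma integrates_conv_psum N t : 0 <= t ->
  integrates t (conv (partial_sum th zs 0 N) t)
    (\sum_(k < N) (weight k)%:C *: (mode (th k) (xs k) t - S t (xs k))).
Proof.
move=> t0; rewrite (_ : conv _ _ = fun s => \sum_(k < N) (weight k)%:C *:
     conv (mode (th k) ((0 +i* th k) *: xs k - A (xs k))) t s); last first.
  by apply/funext => s; exact: psum_mode.
have modeI k := integrates_conv_mode S_C0 S_gen M_ge0 S_bound t0 (th k)
  (let: And5 _ xA _ _ _ := modes (level k) in xA).
exact: (integrates_sum dotE t0 N (fun k => integratesZ (weight k)%:C (modeI k))).
Qed.

Lemma unif_cont_conv_hump t : 0 <= t -> unif_cont t (conv hump t).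
Proof.
move=> t0; apply: (unif_cont_conv M_ge0 S_bound) => e e0.
have [N NP] := trig_series_lim weight_halving hump_small (leq0n d) e0.
exists (partial_sum th zs 0 N) => //.
exact: (integrates_conv_psum N t0).1.
Qed.

Lemma cis_periods k (q : nat) : cis (th k * (q%:R * T)) = 1.
Proof.
elim: q => [|q IH]; first by rewrite mul0r mulr0 cis0.
by rewrite -[q.+1%:R]natr1 mulrDl mul1r hump_per.
Qed.

Lemma budgetE n : budget n = \sum_(k < n) weight k * ((1 + M) * rnorm (xs k)).
Proof.
elim: n => [|n IH]; first by rewrite big_ord0.
by rewrite budgetS IH big_ord_recr.
Qed.

(** The response splits into that of the modes before n, at most the budget,
    that of mode n, at least the budget plus n + 1, and that of the later modes,
    at most T M by the choice of the weights. *)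
Lemma hump_response n v : let t := (p (level n))%:R * T in
  integrates t (conv hump t) v -> n.+1%:R - T * M <= rnorm v.
Proof.
move=> t tv; have t0 : 0 <= t := pT0 _.
pose w k := (weight k)%:C *: (mode (th k) (xs k) t - S t (xs k)).
have vw : rnorm (v - \sum_(k < n.+1) w k) <= T * M.
  apply: (@le_trans _ _ (t * (M * (2 * weight n.+1)))).
    apply: (integrates_norm t0 (integratesB tv (integrates_conv_psum n.+1 t0))).
    move=> s s0 st; rewrite /conv -linearB; apply: le_trans (S_bound _ _) _.
      by rewrite subr_ge0.
    by rewrite ler_wpM2l// hump_close.
  have -> : t * (M * (2 * weight n.+1)) =
      T * M * ((p (level n))%:R * (2 * weight n.+1)) by rewrite /t; ring.
  by rewrite ler_piMr ?weight_periods// mulr_ge0// ltW.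
have w_old : rnorm (\sum_(k < n) w k) <= budget n.
  rewrite budgetE; apply: le_trans (rnorm_sum _ _ _) _; apply: ler_sum => k _.
  rewrite rnormZr (gtr0_norm (weight_gt0 k)) ler_wpM2l ?(ltW (weight_gt0 _))//.
  apply: le_trans (rnormB _ _) _.
  by rewrite rnorm_mode mulrDl mul1r lerD2l S_bound.
have w_new : budget n + n.+1%:R <= rnorm (w n).
  rewrite rnormZr (gtr0_norm (weight_gt0 n)) mulrC -ler_pdivrMr ?weight_gt0//.
  rewrite /mode cis_periods scale1r.
  have [_ _ _ xL xp] := modes (level n).
  have := ler_dist_rnorm (xs n) (S t (xs n)) => /(le_trans (ler_norm _)).
  move: xL xp; rewrite -/(xs n) -/t {1}/level -mulrA; lra.
have := rnormB (\sum_(k < n.+1) w k) (\sum_(k < n) w k).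
rewrite big_ord_recr /= addrAC subrr add0r.
have := rnorm_dist_tri v (\sum_(k < n.+1) w k) 0.
rewrite !subr0 [rnorm (_ - v)]rnorm_distC big_ord_recr /= in vw *.
lra.
Qed.

End GlidingHump.
End Resonance.

(** * Large modes from resolvent growth *)

Lemma generatorZ (R : realType) (H : normedModType R[i])
    (S : R -> {linear H -> H}) (domA : set H) (A : H -> H) (a : R[i]) (x : H) :
  is_generator S domA A -> domA x -> domA (a *: x) /\ A (a *: x) = a *: A x.
Proof.
move=> [domAP AP] xA.
have ax : (h^-1)%:C *: (S h (a *: x) - a *: x) @[h --> 0^'+] --> a *: A x.
  rewrite (_ : (fun h => _) = fun h => a *: ((h^-1)%:C *: (S h x - x))).
    by apply: cvgZ; [apply: cvg_cst|apply: AP].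
  apply/funext => h; rewrite [S h (a *: x)]linearZ /= -scalerBr !scalerA.
  by rewrite mulrC.
have axA : domA (a *: x) by apply/domAP/cvg_ex; exists (a *: A x).
split=> //; exact: (cvg_unique _ (AP _ axA) ax).
Qed.

Section LargeModes.
Variables (R : realType) (H : completeNormedModType R[i]).
Variables (S : R -> {linear H -> H}) (domA : set H) (A : H -> H).
Hypotheses (S_stable : strongly_stable S) (S_gen : is_generator S domA A).
Variables (T : R) (T_gt0 : 0 < T).

Lemma stable_halves x : 0 < rnorm x ->
  exists p : nat, rnorm (S (p%:R * T) x) <= rnorm x / 2.
Proof.
move=> x0; have x2 : 0 < rnorm x / 2 by rewrite divr_gt0.
have [B [_ BP]] := (cvg_rnormP _ _).1 (S_stable x) _ x2.
exists (Num.truncn (`|B| / T)).+1; rewrite ltW//.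
rewrite -[S _ _]subr0; apply: BP; apply: le_lt_trans (ler_norm _) _.
by rewrite -ltr_pdivrMr// truncnS_gt.
Qed.

Lemma resolventP l y : resolvent_set domA A l ->
  domA (resolvent domA A l y) /\
  l *: resolvent domA A l y - A (resolvent domA A l y) = y.
Proof.
move=> [[_ _ surjA] _]; have [x xA xy] := surjA y I.
by apply: (@xgetPex _ 0 [set x | domA x /\ l *: x - A x = y]); exists x.
Qed.

Lemma opnorm_gt (B : H -> H) (r : R) : (r%:E < opnorm B)%E ->
  exists2 y, rnorm y <= 1 & r < rnorm (B y).
Proof.
by move=> /ereal_sup_gt[_ [y y1 <-]]; rewrite lte_fin => ry; exists y.
Qed.

Lemma norm_omega n : `|omega T n| = 2 * pi / T * (`|n|%N)%:R.
Proof.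
rewrite /omega !normrM normfV (gtr0_norm T_gt0) normr_nat.
by rewrite (ger0_norm (pi_ge0 R)) -intr_norm natr_absz mulrAC.
Qed.

(** A near-maximiser y of the resolvent at i omega is scaled down by
    (1 + |omega|)^d.  The forcing then has norm at most 1 in the Sobolev sense,
    and the image under the resolvent still has norm at least
    c (1 + |omega|) / 2, which exceeds L for a suitable frequency. *)
Lemma large_mode_exists (d : nat) (n_ : nat -> int) (c : R) :
  (forall n : int, resolvent_set domA A (0 +i* omega T n)) ->
  `|n_ k|%N @[k --> \oo] --> \oo -> 0 < c ->
  (forall k, ((c * (1 + `|omega T (n_ k)|) ^+ d.+1)%R%:E
      <= opnorm (resolvent domA A (0 +i* omega T (n_ k))%R))%E) ->
  forall L : R, exists theta x p, large_mode S domA A T d L theta x p.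
Proof.
move=> rhoA n_infty c0 res_ge L.
have [k kL] : exists k, L <= c / 2 * (1 + `|omega T (n_ k)|).
  pose N := (Num.truncn (`|L| / (c / 2 * (2 * pi / T)))).+1.
  have [k _ /(_ k (leqnn k)) /= Nk] := (cvgnyPge _).1 n_infty N.
  exists k; rewrite norm_omega mulrDr mulr1; apply: le_trans (ler_norm _) _.
  have C0 : 0 < c / 2 * (2 * pi / T) by rewrite !(divr_gt0, mulr_gt0)// pi_gt0.
  rewrite mulrA ler_wpDl ?divr_ge0 ?(ltW c0)//.
  rewrite mulrC -ler_pdivrMr// ltW//; apply: lt_le_trans (truncnS_gt _) _.
  by rewrite ler_nat.
set theta := omega T (n_ k) in kL; pose q := 1 + `|theta|.
have q1 : 1 <= q by rewrite lerDl.
have q0 : 0 < q := lt_le_trans ltr01 q1.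
have [|y y1 ry] := @opnorm_gt (resolvent domA A (0 +i* theta)) (c / 2 * q ^+ d.+1).
  apply: lt_le_trans (res_ge k); rewrite lte_fin ltr_pM2r ?exprn_gt0//.
  by rewrite ltr_pdivrMr// ltr_pMr// ltr1n.
have [] := resolventP y (rhoA (n_ k)); rewrite -/theta.
set r := resolvent _ _ _ _ in ry * => rA ry_eq.
pose a := (q ^+ d)^-1; have a0 : 0 < a by rewrite invr_gt0 exprn_gt0.
have [xA Ax] := generatorZ a%:C S_gen rA.
have xN : c / 2 * q <= rnorm (a%:C *: r).
  rewrite rnormZr (gtr0_norm a0) /a ler_pdivlMl ?exprn_gt0// mulrCA -exprSr.
  exact: ltW.
have [|p xp] := @stable_halves (a%:C *: r).
  by apply: lt_le_trans xN; rewrite mulr_gt0 ?divr_gt0.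
exists theta, (a%:C *: r), p; split=> //; last exact: le_trans xN.
  by move=> s; apply: cis_omega.
move=> i id; rewrite Ax scalerA [_ * a%:C]mulrC -scalerA -scalerBr ry_eq rnormZr.
rewrite (gtr0_norm a0) mulrA; apply: mulr_ile1 => //.
- by rewrite mulr_ge0 ?exprn_ge0// ltW.
- exact: rnorm_ge0.
rewrite /a ler_pdivrMr ?exprn_gt0// mul1r.
apply: (@le_trans _ _ (q ^+ i)); first by rewrite lerXn2r ?nnegrE ?lerDr// ltW.
exact: ler_weXn2l.
Qed.

End LargeModes.

(** * The theorem *)

Theorem proposition3p5 (R : realType) (H : completeNormedModType R[i])
  (dot : {dot H for Num.conj}) (dotE : forall x : H, `|x| ^+ 2 = dot x x)
  (S : R -> {linear H -> H}) (domA : set H) (A : H -> H)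
  (S_C0 : C0_semigroup S) (S_bounded : uniformly_bounded S)
  (S_stable : strongly_stable S) (S_gen : is_generator S domA A)
  (T : R) (T_gt0 : 0 < T) (m : nat) (m_gt0 : (0 < m)%N)
  (rhoA : forall n : int, resolvent_set domA A (0 +i* omega T n))
  (n_ : nat -> int) (n_inj : injective n_)
  (n_infty : `|n_ k|%N @[k --> \oo] --> \oo)
  (c : R) (c_gt0 : 0 < c)
  (res_ge : forall k,
    ((c * (1 + `|omega T (n_ k)|) ^+ m)%R%:E
      <= opnorm (resolvent domA A (0 +i* omega T (n_ k))%R))%E) :
  exists f : R -> H,
    [/\ sobolev_per T m.-1 f,
        statically_resonant S T f &
        secularly_resonant S f].
Proof.
case: S_bounded => M0 SM0; pose M := `|M0|.
have M_ge0 : 0 <= M := normr_ge0 _.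
have S_bound t x : 0 <= t -> rnorm (S t x) <= M * rnorm x.
  move=> /SM0 /opnorm_le /(_ x) /le_trans; apply.
  by rewrite ler_wpM2r ?rnorm_ge0 ?ler_norm.
case: m m_gt0 res_ge => // d _ res_ge.
have modeP L : exists q : R * H * nat, large_mode S domA A T d L q.1.1 q.1.2 q.2.
  have [theta [x [p xp]]] :=
    large_mode_exists S_stable S_gen T_gt0 rhoA n_infty c_gt0 res_ge L.
  by exists (theta, x, p).
have [q {}modeP] := choice modeP.
pose theta L := (q L).1.1; pose x L := (q L).1.2; pose p L := (q L).2.
have modes L : large_mode S domA A T d L (theta L) (x L) (p L) := modeP L.
pose f := hump A M theta x p.
have fC t (t0 : 0 <= t) : unif_cont t (conv S f t).
  exact: (unif_cont_conv_hump dotE S_C0 S_gen M_ge0 S_bound modes t0).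
have f_unbounded K : exists (p : nat) v,
    integrates (p%:R * T) (conv S f (p%:R * T)) v /\ K < rnorm v.
  pose n := Num.truncn `|K + T * M|.
  pose r := p (level M x p n).
  have rT0 : 0 <= r%:R * T by rewrite mulr_ge0// ltW.
  have [v pv] := integrates_exists dotE rT0 (fC _ rT0).
  exists r, v; split=> //.
  have := hump_response dotE S_C0 S_gen M_ge0 S_bound T_gt0 modes pv.
  apply: lt_le_trans; rewrite ltrBrDr.
  by apply: le_lt_trans (ler_norm _) _; apply: truncnS_gt.
exists f; split.
- exact: (hump_sobolev dotE M T_gt0 modes).
- exact: (unbounded_static dotE S_bound T_gt0 f_unbounded).
- exact: (unbounded_secular dotE T_gt0 fC f_unbounded).
Qed.
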